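(* Assume that the target's velocity $\boldsymbol v=(v_x,v_y)$ is constant. If the minimum-time intercept point $E(t_m)$ between the pursuer and the target lies in the interior of $\mathcal{R}_1\cap\{x>0\}$, i.e. $E(t_m)\in\mathrm{int}(\mathcal{R}_1\cap\{x>0\})$, then the solution path of the Minimum-Time Intercept Problem (MTIP) is of type $R_\alpha S$, and $$G_{cs}(\alpha):=A_1\sin\alpha+A_2\cos\alpha+\alpha\,(A_3\cos\alpha+A_4\sin\alpha)+A_5=0,$$ where $\alpha\in[0,2\pi]$ is the radian of the right-turning circular arc $R_\alpha$ and the constants are $$A_1=-\hat y_0-\rho v_x,\quad A_2=\hat x_0-\rho-\rho v_y,\quad A_3=\rho v_x,\quad A_4=-\rho v_y,\quad A_5=\rho+\rho v_y+\hat y_0v_x-\hat x_0v_y .$$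
   Context: Pursuer (Dubins vehicle): the state is $\boldsymbol z=(x,y,\theta)\in\mathbb{R}^2\times\mathbb{S}^1$ with dynamics $\dot x=\cos\theta$, $\dot y=\sin\theta$, $\dot\theta=u/\rho$, where $u(\cdot)$ is a measurable control with values in $[-1,1]$ and $\rho>0$ is the minimum turning radius. The initial configuration at $t=0$ is $\boldsymbol z_0=(0,0,\pi/2)$. Target: with constant velocity $\boldsymbol v$ and initial position $(\hat x_0,\hat y_0)$, its position is $E(t)=(\hat x_0,\hat y_0)+t\,\boldsymbol v$ for $t\ge 0$. Standing assumption: $\|\boldsymbol v\|<1$ (Euclidean norm), so that the MTIP has a solution. MTIP: find the minimum time $t_m>0$ such that some measurable control $u(\cdot)$ on $[0,t_m]$ steers the pursuer from $\boldsymbol z_0$ at $t=0$ to intercept the target at $t_m$, i.e. $(x(t_m),y(t_m))=E(t_m)$ (final heading free). A solution path is the resulting curve $t\mapsto(x(t),y(t))$ on $[0,t_m]$. Regions: $\mathcal{D}_r=\{(x-\rho)^2+y^2\le\rho^2\}$, $\mathcal{D}_l=\{(x+\rho)^2+y^2\le\rho^2\}$, $\mathcal{R}_2=\mathcal{D}_r\cup\mathcal{D}_l$, $\mathcal{R}_3=\{(x,y)\in\mathbb{R}^2: y>0,\ (x-\rho)^2+y^2\le 9\rho^2,\ (x+\rho)^2+y^2\le 9\rho^2\}\setminus(\mathcal{R}_2\cap\{y>0\})$, and $\mathcal{R}_1=\mathbb{R}^2\setminus(\mathcal{R}_2\cup\mathcal{R}_3)$. Path type $R_\alpha S$: a right-turning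 circular arc of radius $\rho$ and radian $\alpha\ge0$, followed by a straight line segment (tangent to it) of length $d\ge0$. *)

(* Defs.v *)
From mathcomp Require Import all_boot all_order all_algebra.
From mathcomp Require Import all_classical all_reals all_analysis.
Set Implicit Arguments.
Unset Strict Implicit.
Unset Printing Implicit Defensive.
Import Order.TTheory GRing.Theory Num.Theory.
Import numFieldNormedType.Exports.

Local Open Scope classical_set_scope.
Local Open Scope ring_scope.

(* A configuration ((x, y), theta). The heading is represented by a real lift
   theta of the angle in S^1; the dynamics only sees cos theta and sin theta. *)
Definition config (R : realType) : Type := (R * R * R)%type.

Definition pos (R : realType) (z : config R) : R * R := z.1.
Definition heading (R : realType) (z : config R) : R := z.2.

Definition z0 (R : realType) : config R := (0, 0, pi / 2).

(* Measurability is with respect to the Lebesgue sigma-algebra: the library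
   builds it as the Caratheodory sigma-algebra of the outer measure extending
   interval length, which is the domain of completed_lebesgue_measure. *)
Definition lebesgue_measurable_fun (R : realType) (D : set R) (u : R -> R) :=
  @measurable_fun _ _
    (caratheodory_type (mu_ext (@wlength R idfun)))
    (measurableTypeR R) D u.

Definition admissible_control (R : realType) (T : R) (u : R -> R) : Prop :=
  lebesgue_measurable_fun `[0, T] u /\
  forall t, 0 <= t <= T -> - 1 <= u t <= 1.

(* Caratheodory solution on [0, T], starting from z 0 = a, of
   x' = cos theta, y' = sin theta, theta' = u / rho, in integral form.
   Since u is Lebesgue measurable, its integral is taken against the completed
   measure; theta is then continuous, and so are the integrands of x and y. *)
Definition dubins_trajectory (R : realType) (rho T : R) (a : config R)
    (u : R -> R) (z : R -> config R) : Prop :=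
  forall t, 0 <= t <= T ->
  [/\ heading (z t) =
        heading a + (\int[@completed_lebesgue_measure R]_(s in `[0, t])
                        (u s / rho))%R,
      (pos (z t)).1 =
        (pos a).1 + (\int[@lebesgue_measure R]_(s in `[0, t])
                        cos (heading (z s)))%R
    & (pos (z t)).2 =
        (pos a).2 + (\int[@lebesgue_measure R]_(s in `[0, t])
                        sin (heading (z s)))%R].

Definition target (R : realType) (p v : R * R) (t : R) : R * R :=
  (p.1 + t * v.1, p.2 + t * v.2).

(* The library norm on R * R is the sup norm. *)
Definition euclidean_norm (R : realType) (v : R * R) : R :=
  Num.sqrt (v.1 ^+ 2 + v.2 ^+ 2).

Definition intercepts (R : realType) (rho : R) (p v : R * R) (T : R)
    (u : R -> R) (z : R -> config R) : Prop :=
  [/\ admissible_control T u,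
      dubins_trajectory rho T (z0 R) u z
    & pos (z T) = target p v T].

Definition mtip_solution (R : realType) (rho : R) (p v : R * R) (tm : R)
    (u : R -> R) (z : R -> config R) : Prop :=
  [/\ 0 < tm,
      intercepts rho p v tm u z
    & forall T, 0 < T ->
        (exists u' z', intercepts rho p v T u' z') -> tm <= T].

Definition Dr (R : realType) (rho : R) : set (R * R) :=
  [set q | (q.1 - rho) ^+ 2 + q.2 ^+ 2 <= rho ^+ 2].

Definition Dl (R : realType) (rho : R) : set (R * R) :=
  [set q | (q.1 + rho) ^+ 2 + q.2 ^+ 2 <= rho ^+ 2].

Definition R2 (R : realType) (rho : R) : set (R * R) := Dr rho `|` Dl rho.

Definition R3 (R : realType) (rho : R) : set (R * R) :=
  [set q | [/\ 0 < q.2,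
               (q.1 - rho) ^+ 2 + q.2 ^+ 2 <= 9 * rho ^+ 2
             & (q.1 + rho) ^+ 2 + q.2 ^+ 2 <= 9 * rho ^+ 2]]
  `\` (R2 rho `&` [set q | 0 < q.2]).

Definition R1 (R : realType) (rho : R) : set (R * R) :=
  ~` (R2 rho `|` R3 rho).

(* Configuration reached from a after travelling a length s along the
   right-turning (clockwise) circle of radius rho tangent to a; its center is
   pos a + rho * (sin (heading a), - cos (heading a)). *)
Definition right_arc (R : realType) (rho : R) (a : config R) (s : R) :
    config R :=
  ((pos a).1 + rho * (sin (heading a) - sin (heading a - s / rho)),
   (pos a).2 + rho * (cos (heading a - s / rho) - cos (heading a)),
   heading a - s / rho).

Definition straight (R : realType) (a : config R) (s : R) : config R :=
  ((pos a).1 + s * cos (heading a), (pos a).2 + s * sin (heading a),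
   heading a).

(* The planar curve gamma, parametrized by arc length on [0, T], is a path
   R_alpha S issued from a with straight segment of length d. *)
Definition path_RS (R : realType) (rho : R) (a : config R) (alpha d T : R)
    (gamma : R -> R * R) : Prop :=
  [/\ 0 <= alpha, 0 <= d, T = rho * alpha + d,
      forall t, 0 <= t <= rho * alpha -> gamma t = pos (right_arc rho a t)
    & forall t, rho * alpha <= t <= T ->
        gamma t = pos (straight (right_arc rho a (rho * alpha))
                                (t - rho * alpha))].

Definition Gcs (R : realType) (rho : R) (p v : R * R) (alpha : R) : R :=
  let A1 := - p.2 - rho * v.1 in
  let A2 := p.1 - rho - rho * v.2 in
  let A3 := rho * v.1 in
  let A4 := - (rho * v.2) in
  let A5 := rho + rho * v.2 + p.2 * v.1 - p.1 * v.2 in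
  A1 * sin alpha + A2 * cos alpha
    + alpha * (A3 * cos alpha + A4 * sin alpha) + A5.

(* Main.v *)
Require Import Defs.
From mathcomp Require Import all_boot all_order all_algebra.
From mathcomp Require Import ring lra.
From mathcomp Require Import all_classical all_reals all_analysis.
From mathcomp Require Import measurable_realfun.
Import Order.TTheory GRing.Theory Num.Theory.
Import numFieldNormedType.Exports.
Local Open Scope classical_set_scope.
Local Open Scope ring_scope.

(* For q in R_1 with x > 0, every time at least the length V(q) of the path
   R_alpha S to q is attained by some trajectory to q (prepend a left arc and a
   straight segment and vary their lengths), and V is continuous there. Hence
   t_m <= V(E(t_m)): otherwise V(E(t)) < t for t slightly before t_m, and the
   target would be intercepted at t. So the solution reaches q = E(t_m) within
   the time V(q), and it remains to see that only the path R_alpha S does so.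
   If alpha <= pi, project on the final direction of this path. If alpha > pi,
   q lies behind the pursuer, between the two lines at distance 2 rho from its
   axis. While this persists, V of the current configuration plus the elapsed
   time is nondecreasing, and constant only along the right arc; q leaves the
   strip either where alpha = pi, or on the other side after crossing the axis,
   where the symmetric functions for right and left turns coincide.
   The equation for alpha follows by eliminating d from q = E(t_m). *)

Set Implicit Arguments.
Unset Strict Implicit.

(** * Trajectories as Lipschitz headings *)

(** The obstacle is alpha > pi. After a time s the heading is within s / rho of its initial value,
    and the right turn is the best approach to the final direction only while turning left is not
    the shorter way round, that is for alpha <= pi; projecting on one fixed direction says nothing
    beyond a half turn. There the elapsed time plus V of the current configuration serves as the
    monotone quantity instead. It must be handed over to the projection at a moment when the
    remaining angle is pi; for q behind the pursuer this is the edge of the strip, X = 2 rho in the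
    moving frame. Each monotonicity statement comes with its equality case, because the shape of the
    path is read off from equality: t_m <= V together with the growth of the monotone quantity
    leaves no slack anywhere. Neither a maximum principle nor an existence theorem enters; all
    comparison curves are explicit. *)

Section Heading.
Variable R : realType.
Implicit Types (rho T s t : R) (u : R -> R).
Notation clm := (@completed_lebesgue_measure R).
Notation ctype := (caratheodory_type (mu_ext (@wlength R idfun))).

Lemma lebesgue_measurable_itv (i : interval R) :
  measurable ([set` i] : set ctype).
Proof. apply: sub_caratheodory; exact: measurable_itv. Qed.

Lemma completed_itv (s t : R) (b1 b2 : bool) : s <= t ->
  clm [set` Interval (BSide b1 s) (BSide b2 t)] = (t - s)%:E.
Proof.
move=> st.
rewrite (_ : clm _ = lebesgue_measure [set` Interval (BSide b1 s) (BSide b2 t)]) //.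
rewrite lebesgue_measure_itv /= lte_fin.
by case: ltP => // ts; rewrite (@le_anti _ _ t s) ?ts // subrr.
Qed.

Lemma Rintegral_completed_cst (s t k : R) : s <= t ->
  \int[clm]_(_ in `]s, t]) k = k * (t - s).
Proof.
move=> st; rewrite Rintegral_cst; last exact: lebesgue_measurable_itv.
congr (_ * _); exact: (congr1 fine (completed_itv _ _ st)).
Qed.

Lemma control_integrable rho T u (i : interval R) :
  0 < rho -> admissible_control T u -> [set` i] `<=` `[0, T] ->
  clm.-integrable [set` i] (EFin \o (fun r => u r / rho)).
Proof.
move=> rho0 [mu ub] iT.
have mi := lebesgue_measurable_itv i.
have m0T := lebesgue_measurable_itv `[0, T].
apply: measurable_bounded_integrable; first exact: mi.
- have [T0|T0] := leP 0 T.
    apply: (@le_lt_trans _ _ (clm `[0, T]%classic)).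
      by apply: le_measure; rewrite ?inE.
    by rewrite completed_itv // ltry.
  have -> : [set` i] = set0.
    by apply/seteqP; split => // x /iT /=; rewrite in_itv /=; lra.
  by rewrite measure0.
- apply: (measurable_funS m0T iT).
  by apply: measurable_funM => //; exact: measurable_cst.
- exists (rho^-1); split => [|M hM x /= xi]; first exact: num_real.
  apply: le_trans (ltW hM).
  rewrite normrM normfV (gtr0_norm rho0); apply: ler_piMl.
    by rewrite invr_ge0 ltW.
  by rewrite ler_norml; have := iT _ xi; rewrite /= in_itv /= => /ub.
Qed.

Lemma trajectory_headingB rho T a u z s t :
  0 < rho -> admissible_control T u -> dubins_trajectory rho T a u z ->
  0 <= s -> s <= t -> t <= T ->
  heading (z t) - heading (z s) = (\int[clm]_(r in `]s, t]) (u r / rho))%R.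
Proof.
move=> rho0 adm tr s0 st tT.
have [|-> _ _] := tr t; first lra.
have [|-> _ _] := tr s; first lra.
have -> : `[0, t]%classic = `[0, s] `|` `]s, t].
  by rewrite -itv_bndbnd_setU // bnd_simp.
rewrite Rintegral_setU.
- by rewrite addrA [LHS]addrC addKr.
- exact: lebesgue_measurable_itv.
- exact: lebesgue_measurable_itv.
- rewrite -itv_bndbnd_setU ?bnd_simp //.
  apply: control_integrable adm _ => // x /=; rewrite !in_itv /=; lra.
- apply/disj_setPS => x /=; rewrite !in_itv /=; lra.
Qed.

Lemma trajectory_heading_lipschitz rho T a u z s t :
  0 < rho -> admissible_control T u -> dubins_trajectory rho T a u z ->
  0 <= s -> s <= t -> t <= T ->
  `|heading (z t) - heading (z s)| <= (t - s) / rho.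
Proof.
move=> rho0 adm tr s0 st tT.
rewrite (@trajectory_headingB rho T a u z s t) //.
have sub : `]s, t] `<=` `[0, T] by move=> x /=; rewrite !in_itv /=; lra.
have mi := lebesgue_measurable_itv `]s, t].
have fin : (clm `]s, t] < +oo)%E by rewrite completed_itv // ltry.
have int : clm.-integrable `]s, t] (EFin \o (fun r => u r / rho)).
  exact: control_integrable adm _.
apply: (le_trans (le_normr_Rintegral _ int)) => //.
apply: (@le_trans _ _ (\int[clm]_(r in `]s, t]) rho^-1)%R).
  apply: le_Rintegral => //.
  - exact: (integrable_abse int).
  - apply: measurable_bounded_integrable; first exact: mi.
    + exact: fin.
    + exact: measurable_cst.
    + exact: bounded_cst.
  - move=> x /sub /=; rewrite in_itv /= => x0T.
    rewrite normrM normfV (gtr0_norm rho0); apply: ler_piMl.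
      by rewrite invr_ge0 ltW.
    by rewrite ler_norml; apply adm.2.
by rewrite Rintegral_completed_cst // mulrC.
Qed.

Lemma trajectory_heading_const rho T a u z s t k :
  0 < rho -> admissible_control T u -> dubins_trajectory rho T a u z ->
  0 <= s -> s <= t -> t <= T -> (forall r, s < r <= t -> u r = k) ->
  heading (z t) = heading (z s) + k * (t - s) / rho.
Proof.
move=> rho0 adm tr s0 st tT uk.
apply/eqP; rewrite addrC -subr_eq; apply/eqP.
rewrite (@trajectory_headingB rho T a u z s t) //.
rewrite (@eq_Rintegral _ _ _ _ _ (fun=> k / rho)); last first.
  by move=> x; rewrite inE /= in_itv /= => /uk ->.
by rewrite Rintegral_completed_cst // mulrAC.
Qed.

End Heading.

(** * Planar curves driven by a Lipschitz heading *)

Section Curve.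
Variable R : realType.
Implicit Types (rho T s t : R) (u : R -> R).
Notation mu := (@lebesgue_measure R).

(** The control is forgotten: optimality uses only the Lipschitz bound on the heading, which passes
    to subintervals and mirror images. Continuity and derivatives are two-sided even at [a] and
    [b]. *)
Definition dubins_curve (rho a b : R) (th x y : R -> R) : Prop :=
  [/\ forall s t, a <= s -> s <= t -> t <= b -> `|th t - th s| <= (t - s) / rho,
      forall t, a <= t <= b -> {for t, continuous th},
      forall t, a <= t <= b -> is_derive t 1 x (cos (th t))
    & forall t, a <= t <= b -> is_derive t 1 y (sin (th t))].

Lemma lipschitz_continuous_at (f : R -> R) k t :
  0 < k -> (forall r s, `|f r - f s| <= k * `|r - s|) -> {for t, continuous f}.
Proof.
move=> k0 fl; apply/cvgrPdist_le => /= e e0; near=> r.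
apply: (le_trans (fl _ _)); rewrite -ler_pdivlMl //.
near: r.
have e1 : 0 < k^-1 * e by rewrite mulr_gt0 ?invr_gt0.
have /cvgrPdist_le : (id : R -> R) r @[r --> t] --> t by exact: cvg_id.
by move=> /(_ _ e1).
Unshelve. all: by end_near. Qed.

Lemma continuous_primitive (f : R -> R) T : continuous f -> 0 <= T ->
  exists F : R -> R,
    (forall t, 0 <= t <= T -> is_derive t 1 F (f t)) /\
    (forall t, 0 <= t <= T -> F t = (\int[mu]_(r in `[0, t]) f r)%R).
Proof.
move=> cf T0.
have int a b : mu.-integrable `[a, b] (EFin \o f).
  apply: continuous_compact_integrable; first exact: segment_compact.
  exact: continuous_subspaceT.
(* Starting at -1, and applying the fundamental theorem up to T + 1, makes 0 and T interior points,
   so that the derivative is two-sided there. *)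
pose G t := (\int[mu]_(r in `[(- 1), t]) f r)%R.
exists (fun t => G t - G 0); split => t /andP[t0 tT].
  have [||||dG dE] := @continuous_FTC1_closed R f (-1) t (T + 1).
  - lra.
  - exact: int.
  - lra.
  - exact: cf.
  have HG : is_derive t 1 G (f t) by rewrite -dE derive1E; exact/derivableP.
  rewrite -[f t]subr0; exact: is_deriveB.
rewrite /G (@Rintegral_itvB _ _ _ _ 0 (int _ _)) ?bnd_simp ?lerN10 //.
rewrite Rintegral_itv_obnd_cbnd //.
by apply: integrableS (int 0 t) => //; apply: subset_itvr; rewrite bnd_simp.
Qed.

(** Freezing time outside [0, T] extends the heading to a Lipschitz function on the whole line,
    whose cosine and sine then have primitives across both endpoints. *)
Definition clamp T t := Num.max 0 (Num.min T t).

Lemma clamp_id T t : 0 <= t <= T -> clamp T t = t.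
Proof. by move=> /andP[t0 tT]; rewrite /clamp min_r // max_r. Qed.

Lemma clamp_itv T t : 0 <= T -> 0 <= clamp T t <= T.
Proof. by move=> T0; rewrite /clamp le_max lexx /= ge_max T0 ge_min lexx. Qed.

Lemma clampB T s t : 0 <= T -> s <= t -> 0 <= clamp T t - clamp T s <= t - s.
Proof.
move=> T0 st; rewrite /clamp.
by have [?|?] := leP T t; have [?|?] := leP T s; case: (leP 0 T);
  case: (leP 0 t); case: (leP 0 s); rewrite ?maxEle ?minEle; lra.
Qed.

Lemma trajectory_curve rho T a u (z : R -> config R) :
  0 < rho -> 0 <= T -> admissible_control T u -> dubins_trajectory rho T a u z ->
  exists th x y, dubins_curve rho 0 T th x y /\
    forall t, 0 <= t <= T -> z t = ((x t, y t), th t).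
Proof.
move=> rho0 T0 adm tr.
pose th t := heading (z (clamp T t)).
have thL s t : s <= t -> `|th t - th s| <= (t - s) / rho.
  move=> st; have /andP[c1 c2] := clampB T0 st.
  have /andP[c3 _] := clamp_itv s T0; have /andP[_ c4] := clamp_itv t T0.
  apply: le_trans (_ : (clamp T t - clamp T s) / rho <= _).
    apply: (@trajectory_heading_lipschitz _ rho T a u) => //; lra.
  by rewrite ler_pM2r ?invr_gt0.
have cth : continuous th.
  move=> t; apply: (@lipschitz_continuous_at _ rho^-1); rewrite ?invr_gt0 //.
  move=> r s; have [rs|sr] := leP r s.
    rewrite distrC (distrC r) (ger0_norm (x := s - r)) ?subr_ge0 // mulrC.
    exact: thL.
  rewrite (ger0_norm (x := r - s)) ?subr_ge0 ?(ltW sr) // mulrC.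
  exact: thL _ _ (ltW sr).
have ccos : continuous (cos \o th).
  by move=> t; apply: continuous_comp; [exact: cth|exact: continuous_cos].
have csin : continuous (sin \o th).
  by move=> t; apply: continuous_comp; [exact: cth|exact: continuous_sin].
have [X [dX XE]] := continuous_primitive ccos T0.
have [Y [dY YE]] := continuous_primitive csin T0.
have thE r t : t <= T -> r \in `[0, t]%classic -> th r = heading (z r).
  rewrite inE /= in_itv /= => tT /andP[r0 rt].
  by rewrite /th clamp_id // r0 (le_trans rt).
exists th, (fun t => (pos a).1 + X t), (fun t => (pos a).2 + Y t); split.
  split => [s t _ st _|t _|t tT|t tT].
  - exact: thL.
  - exact: cth.
  - rewrite -[cos _]add0r; apply: is_deriveD; exact: dX.
  - rewrite -[sin _]add0r; apply: is_deriveD; exact: dY.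
move=> t t0T; have /andP[t0 tT] := t0T.
have [E1 E2 E3] := tr t t0T; rewrite XE // YE //.
rewrite [z t]surjective_pairing [(z t).1]surjective_pairing.
congr ((_, _), _).
- rewrite [LHS]E2; congr (_ + _); apply: eq_Rintegral => r rt /=.
  by rewrite (thE r t).
- rewrite [LHS]E3; congr (_ + _); apply: eq_Rintegral => r rt /=.
  by rewrite (thE r t).
- by rewrite /th clamp_id.
Qed.

End Curve.

(** * One-dimensional calculus *)

Section Calculus.
Variable R : realType.
Implicit Types (f g df : R -> R) (a b c t : R).

Definition continuous_on a b f := forall t, a <= t <= b -> {for t, continuous f}.

Lemma derive_continuous_on f df a b :
  (forall t, a <= t <= b -> is_derive t 1 f (df t)) -> continuous_on a b f.
Proof.
move=> fd t tab; apply/differentiable_continuous/derivable1_diffP.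
by apply: ex_derive; exact: fd.
Qed.

Lemma continuous_on_within f a b :
  continuous_on a b f -> {within `[a, b], continuous f}.
Proof.
move=> cf; apply: continuous_in_subspaceT => t.
by rewrite inE /= in_itv /= => /cf.
Qed.

Lemma derive_ge0_le f df a b : a <= b ->
  (forall t, a <= t <= b -> is_derive t 1 f (df t)) ->
  (forall t, a < t < b -> 0 <= df t) -> f a <= f b.
Proof.
rewrite le_eqVlt => /predU1P[->//|ab] fd df0.
have [|| c] := @MVT R f df a b ab.
- by move=> t; rewrite in_itv /= => tab; apply: fd; lra.
- exact/continuous_on_within/(derive_continuous_on fd).
rewrite in_itv /= => cab E; rewrite -subr_ge0 E mulr_ge0 //; last lra.
exact: df0.
Qed.

Lemma derive_eq0_eq f df a b : a <= b ->
  (forall t, a <= t <= b -> is_derive t 1 f (df t)) ->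
  (forall t, a < t < b -> df t = 0) -> f a = f b.
Proof.
move=> ab fd df0; apply/le_anti/andP; split.
  by apply: (derive_ge0_le ab fd) => t /df0 ->.
rewrite -lerN2; apply: (@derive_ge0_le (fun t => - f t) (fun t => - df t)) => //.
  by move=> t /fd ?; exact: is_deriveN.
by move=> t /df0 ->; rewrite oppr0.
Qed.

(** Equality case of the monotonicity arguments: a nondecreasing function that does not grow is
    constant, so its derivative vanishes at every interior point. This recovers the heading at each
    time. *)
Lemma derive_ge0_eq f df a b :
  (forall t, a <= t <= b -> is_derive t 1 f (df t)) ->
  (forall t, a < t < b -> 0 <= df t) -> f b <= f a ->
  forall t, a < t < b -> df t = 0.
Proof.
move=> fd df0 fba t /andP[at' tb].
have cst r : a <= r <= b -> f r = f a.
  move=> /andP[ar rb]; apply/le_anti/andP; split.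
    apply: le_trans fba; apply: (derive_ge0_le rb) => s sr; [apply: fd|apply: df0]; lra.
  apply: (derive_ge0_le ar) => s sr; [apply: fd|apply: df0]; lra.
have fdt : is_derive t 1 f (df t) by apply: fd; lra.
have fd0 : is_derive t 1 f 0.
  apply: (@near_eq_is_derive _ _ _ (fun=> f a) f) => //.
  near=> r; rewrite cst //; apply/andP; split; apply: ltW.
  - by near: r; exact: lt_nbhsr.
  - by near: r; exact: lt_nbhsl.
by rewrite -(@derive_val _ _ _ _ _ _ _ fdt) (@derive_val _ _ _ _ _ _ _ fd0).
Unshelve. all: by end_near. Qed.

Lemma first_hit g a b c : a <= b -> continuous_on a b g -> g a < c -> c <= g b ->
  exists tau, [/\ a < tau, tau <= b, g tau = c & forall t, a <= t < tau -> g t < c].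
Proof.
move=> ab cg gac cgb.
pose A := [set t | a <= t <= b /\ c <= g t].
have Ab : A b by split=> //; rewrite ab lexx.
have lA : lbound A a by move=> t [/andP[]].
have hA : has_inf A by split; [exists b|exists a].
pose tau := inf A.
have at' : a <= tau by apply: lb_le_inf => //; exists b.
have tb : tau <= b by apply: ge_inf => //; exists a.
have ctau : {for tau, continuous g} by apply: cg; rewrite at' tb.
have below t : a <= t < tau -> g t < c.
  move=> /andP[a_t ttau]; rewrite ltNge; apply/negP => cgt.
  have : tau <= t by apply: ge_inf; [exists a|split=> //; lra].
  lra.
have gtau : c <= g tau.
  rewrite leNgt; apply/negP => gc.
  have : \forall r \near tau, g r < c by apply: (cvgr_lt _ ctau).
  move=> /nbhs_ballP[e /= e0 He].
  have [r [rab cr] rt] := inf_adherent e0 hA.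
  have rtau : tau <= r by apply: ge_inf; [exists a|].
  have : g r < c.
    apply: He; rewrite /ball /= ler0_norm; rewrite -/tau in rt *; lra.
  lra.
have atau : a < tau.
  by rewrite lt_neqAle at' andbT; apply/eqP => E; rewrite -E in gtau; lra.
exists tau; split => //; apply/le_anti; rewrite gtau andbT leNgt; apply/negP => gc.
have : \forall r \near tau, c < g r by apply: (cvgr_gt _ ctau).
move=> /nbhs_ballP[e /= e0 He].
pose r := Num.max a (tau - e / 2).
have [ar rt] : a <= r /\ r < tau by rewrite /r le_max lexx gt_max atau; split => //; lra.
have re : tau - e / 2 <= r by rewrite /r le_max lexx orbT.
have : c < g r by apply: He; rewrite /ball /= ger0_norm; lra.
by have := below r; rewrite ar rt => /(_ isT); lra.
Qed.

(* Headings are merely Lipschitz, so functions of the configuration need not be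
   differentiable along a trajectory. *)
Lemma dini_le f a b : a <= b -> continuous_on a b f ->
  (forall t, a <= t < b -> forall e, 0 < e ->
    \forall r \near t^'+, f t - e * (r - t) <= f r) ->
  f a <= f b.
Proof.
move=> ab cf dini.
suff H e : 0 < e -> f a - e * (b - a) <= f b.
  rewrite leNgt; apply/negP => fba.
  have k : 0 < b - a + 1 by lra.
  have := H ((f a - f b) / (b - a + 1) / 2).
  have k1 : 0 < (f a - f b) / (b - a + 1) by rewrite divr_gt0 //; lra.
  have k2 : (f a - f b) / (b - a + 1) * (b - a + 1) = f a - f b.
    by rewrite divfK // gt_eqF.
  move=> /(_ ltac:(lra)); nra.
move=> e0; rewrite leNgt; apply/negP => fb.
(* [g] is s |-> f s + e * (s - a) run backwards in time, so its first hit of f a is the last time t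
   < b at which that function equals f a. It stays below f a after t, whereas the hypothesis at t
   keeps it above just to the right. *)
pose g r := f (a + b - r) + e * (b - r).
have [|||tau [atau taub gtau below]] := @first_hit g a b (f a) ab.
- move=> t /andP[a_t tb]; apply: (@continuousD _ _ _ (fun r => f (a + b - r))).
    apply: (@continuous_comp _ _ _ (fun r => a + b - r) f).
      apply: continuousB; [exact: cvg_cst|exact: cvg_id].
    by apply: cf; lra.
  apply: continuousM; first exact: cvg_cst.
  apply: continuousB; [exact: cvg_cst|exact: cvg_id].
- rewrite /g (_ : a + b - a = b); [lra|ring].
- rewrite /g (_ : a + b - b = a); [lra|ring].
pose t := a + b - tau.
have tab : a <= t < b by rewrite /t; lra.
have /(_ tab e e0) := dini t.
move=> N.
have : \forall r \near t^'+, False; last first.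
  by move=> /filter_ex[].
near=> r.
have tr : t < r by near: r; exact: nbhs_right_gt.
have rb : r < b by near: r; apply: nbhs_right_lt; lra.
have fr : f t - e * (r - t) <= f r by near: r.
have := below (a + b - r); rewrite /g (_ : a + b - (a + b - r) = r); last ring.
have te : tau = a + b - t by rewrite /t; ring.
have lt_r : a <= a + b - r < tau by rewrite te; lra.
move=> /(_ lt_r); rewrite -gtau /g -/t te.
rewrite (_ : f t + e * (b - (a + b - t)) = f t - e * (r - t) + e * (b - (a + b - r))); last ring.
by rewrite ltrD2r ltNge fr.
Unshelve. all: by end_near. Qed.

End Calculus.

(** * Paths R_alpha S with alpha <= pi *)

Section Calibration.
Variable R : realType.
Implicit Types (rho a b : R) (th x y : R -> R).

Lemma is_derive_lincomb f g df dg (c1 c2 c0 t : R) :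
  is_derive t 1 f df -> is_derive t 1 g dg ->
  is_derive t 1 (fun r => c1 * f r + c2 * g r + c0) (c1 * df + c2 * dg).
Proof.
move=> fd gd.
have fZ := @is_deriveZ R R R f c1 t 1 df fd.
have gZ := @is_deriveZ R R R g c2 t 1 dg gd.
have fgD := @is_deriveD R R R _ _ t 1 _ _ fZ gZ.
have H := @is_deriveD R R R _ _ t 1 _ _ fgD (is_derive_cst c0 t 1).
by rewrite addr0 in H.
Qed.

Lemma is_derive_affine (c k a t : R) : is_derive t 1 (fun r : R => c + k * (r - a)) k.
Proof.
have -> : (fun r => c + k * (r - a)) = (fun r : R => k * r + 0 * r + (c - k * a)).
  by apply/funext => r; ring.
rewrite -[X in is_derive _ _ _ X](_ : k * 1 + 0 * 1 = k); last ring.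
by apply: is_derive_lincomb; exact: is_derive_id.
Qed.

Lemma is_derive_sin_affine (c k a t : R) :
  is_derive t 1 (fun r : R => sin (c + k * (r - a))) (k * cos (c + k * (t - a))).
Proof.
have := is_derive_affine c k a t => H.
have := @is_derive1_comp R (@sin R) (fun r : R => c + k * (r - a)) t _ _ (is_derive_sin _) H.
by rewrite mulrC.
Qed.

Lemma is_derive_cos_affine (c k a t : R) :
  is_derive t 1 (fun r : R => cos (c + k * (r - a))) (- (k * sin (c + k * (t - a)))).
Proof.
have := is_derive_affine c k a t => H.
have := @is_derive1_comp R (@cos R) (fun r : R => c + k * (r - a)) t _ _ (is_derive_cos _) H.
by rewrite -mulNr mulrC mulNr -mulrN.
Qed.

Lemma cos_2piB (w : R) : cos (2 * pi - w) = cos w.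
Proof. by rewrite (_ : 2 * pi - w = - w + pi *+ 2) ?cosD2pi ?cosN //; ring. Qed.

(** Cosine decreases on [0, pi] and is symmetric about pi. In the calibration v = alpha - s and w
    ranges over [alpha - s, alpha + s], where s is the largest possible turn so far; w <= 2 pi - v
    is then guaranteed by alpha <= pi. *)
Lemma cos_le_sym (v w : R) : 0 <= v <= pi -> v <= w <= 2 * pi - v ->
  cos w <= cos v.
Proof.
have lecos (p q : R) : 0 <= p -> p <= q -> q <= pi -> cos q <= cos p.
  move=> p0 pq qpi; have [<-//|pq'] := eqVneq p q; apply: ltW.
  by rewrite ltr_cos ?lt_neqAle ?pq' // in_itv /=; apply/andP; split; lra.
move=> /andP[v0 vpi] /andP[vw wv]; have [wpi|piw] := leP w pi.
  exact: lecos.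
rewrite -(cos_2piB w); apply: lecos => //; lra.
Qed.

Lemma cos_eq_sym (v w : R) : 0 <= v <= pi -> v <= w <= 2 * pi - v ->
  cos w = cos v -> w = v \/ w = 2 * pi - v.
Proof.
move=> /andP[v0 vpi] /andP[vw wv]; have [wpi|piw] := leP w pi => E; [left|right].
  by apply: (@cos_inj R) => //; rewrite in_itv /=; apply/andP; split; lra.
have : 2 * pi - w = v; last lra.
apply: (@cos_inj R); rewrite ?in_itv /= ?cos_2piB //; apply/andP; split; lra.
Qed.

(* Projecting on the final direction of the RS path: since |th t - th a| <= (t - a) / rho,
   no admissible heading makes a smaller angle with that direction than the RS path does. *)
Lemma RS_calibration rho a b th x y (alpha d : R) :
  0 < rho -> a < b -> dubins_curve rho a b th x y ->
  0 <= alpha <= pi -> 0 <= d ->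
  x b = x a + rho * (sin (th a) - sin (th a - alpha)) + d * cos (th a - alpha) ->
  y b = y a + rho * (cos (th a - alpha) - cos (th a)) + d * sin (th a - alpha) ->
  b - a <= rho * alpha + d ->
  [/\ b = a + rho * alpha + d,
      forall t, a < t < a + rho * alpha -> th t = th a - (t - a) / rho
    & forall t, a + rho * alpha < t < b ->
        cos (th t) = cos (th a - alpha) /\ sin (th t) = sin (th a - alpha)].
Proof.
move=> rho0 ab [thL cth dx dy] /andP[al0 alpi] d0 xb yb ble.
set phi := th a - alpha in xb yb *.
pose P t := cos phi * x t + sin phi * y t + 0.
have dP t : a <= t <= b -> is_derive t 1 P (cos (th t - phi)).
  by move=> tab; rewrite cosB mulrC [X in _ + X]mulrC; apply: is_derive_lincomb; [exact: dx|exact: dy].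
have PbE : P b - P a = rho * sin alpha + d.
  have -> : sin alpha = sin (th a) * cos phi - cos (th a) * sin phi.
    by rewrite -sinB; congr sin; rewrite /phi; ring.
  have := cos2Dsin2 phi.
  rewrite /P xb yb => E.
  transitivity (rho * (sin (th a) * cos phi - cos (th a) * sin phi) + d * (cos phi ^+ 2 + sin phi ^+ 2)).
    ring.
  by rewrite E mulr1.
have dist t : a <= t -> t <= b ->
    - ((t - a) / rho) <= th t - th a <= (t - a) / rho.
  by move=> at' tb; rewrite -ler_norml; apply: thL.
have below_m t : (t < a + rho * alpha) = ((t - a) / rho < alpha).
  by rewrite ltr_pdivrMr // ltrBlDr addrC mulrC.
have r0 t : a <= t -> 0 <= (t - a) / rho.
  by move=> at'; apply: divr_ge0; lra.
have argE t : alpha + (- rho^-1) * (t - a) = alpha - (t - a) / rho.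
  by rewrite mulNr mulrC.
(* Up to a constant, [F] is the progress of the right arc in the direction phi minus that of the
   curve; [G] below plays the same role for the straight segment. *)
pose F t := (- rho) * sin (alpha + (- rho^-1) * (t - a)) + (- 1) * P t + 0.
pose dF t := (- rho) * ((- rho^-1) * cos (alpha + (- rho^-1) * (t - a))) + (- 1) * cos (th t - phi).
have dFE t : dF t = cos (alpha - (t - a) / rho) - cos (th t - phi).
  by rewrite /dF argE mulrA mulrNN mulfV ?gt_eqF // mul1r mulN1r.
have dFd t : a <= t <= b -> is_derive t 1 F (dF t).
  by move=> tab; apply: is_derive_lincomb; [exact: is_derive_sin_affine|exact: dP].
have dF0 t : a < t < b -> t < a + rho * alpha -> 0 <= dF t.
  move=> /andP[at' tb]; rewrite below_m dFE subr_ge0 => tal.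
  have := dist t (ltW at') (ltW tb); have := r0 t (ltW at') => t0 /andP[d1 d2].
  by apply: cos_le_sym; rewrite /phi; clear -d1 d2 t0 tal alpi; apply/andP; split; lra.
have FE t : F t = - rho * sin (alpha - (t - a) / rho) - P t.
  by rewrite /F argE addr0 mulN1r.
(* A curve ending before the arc is completed would progress by strictly less than rho * sin alpha,
   and so miss rho * sin alpha + d. *)
have mb : a + rho * alpha <= b.
  rewrite leNgt; apply/negP => bm.
  have := bm; rewrite below_m => bm'.
  have FF : F a <= F b.
    by apply: (derive_ge0_le (ltW ab) dFd) => t tab; apply: dF0 => //; lra.
  have : 0 < sin (alpha - (b - a) / rho).
    apply: sin_gt0_pi; have : 0 < (b - a) / rho by rewrite divr_gt0 // subr_gt0.
    by move=> ?; apply/andP; split; lra.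
  move=> s0; have : 0 < rho * sin (alpha - (b - a) / rho) by rewrite mulr_gt0.
  move: FF; rewrite !FE subrr mul0r subr0; lra.
set m := a + rho * alpha in below_m dF0 mb *.
have am : a <= m by rewrite /m lerDl mulr_ge0 // ltW.
have mrho : (m - a) / rho = alpha by rewrite /m addrAC subrr add0r mulrC mulKf // gt_eqF.
have FF : F a <= F m.
  apply: (derive_ge0_le am (f := F) (df := dF)) => t tab; first by apply: dFd; clear -tab mb; lra.
  by apply: dF0; clear -tab mb; lra.
pose G t := (- 1) * P t + 1 * id t + 0.
pose dG t := (- 1) * cos (th t - phi) + 1 * 1.
have dGd t : a <= t <= b -> is_derive t 1 G (dG t).
  by move=> tab; apply: is_derive_lincomb; exact: dP.
have dG0 t : 0 <= dG t by rewrite /dG; have := cos_le1 (th t - phi); lra.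
have GG : G m <= G b.
  apply: (derive_ge0_le mb (f := G) (df := dG)) => t tab.
    by apply: dGd; lra.
  exact: dG0.
have Fa : F a = - rho * sin alpha - P a by rewrite FE subrr mul0r subr0.
have Fm : F m = - P m by rewrite FE mrho subrr sin0 mulr0 add0r.
have Gm : G m = m - P m by rewrite /G /=; ring.
have Gb : G b = b - P b by rewrite /G /=; ring.
have bE : b = a + rho * alpha + d by move: FF GG ble; rewrite Fa Fm Gm Gb /m; lra.
have Fam : F m <= F a by move: GG; rewrite Fa Fm Gm Gb /m; lra.
have Gmb : G b <= G m by move: FF; rewrite Fa Fm Gm Gb /m; lra.
have flatF : forall t, a < t < m -> dF t = 0.
  apply: (derive_ge0_eq (f := F)) Fam => t tam; first by apply: dFd; clear -tam mb; lra.
  by apply: dF0; clear -tam mb; lra.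
have flatG : forall t, m < t < b -> dG t = 0.
  by apply: (derive_ge0_eq (f := G)) Gmb => t tmb; [apply: dGd; clear -tmb am; lra|exact: dG0].
have final t : m < t < b -> cos (th t) = cos phi /\ sin (th t) = sin phi.
  move=> /flatG; rewrite /dG => E.
  have c1 : cos (th t - phi) = 1 by clear -E; lra.
  have s0 : sin (th t - phi) = 0 by apply: cos1sin0; rewrite c1 normr1.
  have := cosD (th t - phi) phi; have := sinD (th t - phi) phi.
  by rewrite subrK c1 s0 => -> ->; split; ring.
have turn t : a < t < m ->
    th t = th a - (t - a) / rho \/ alpha = pi /\ th t = th a + (t - a) / rho.
  move=> /andP[at' tm].
  have tb : t <= b by clear -tm mb; lra.
  have := dist t (ltW at') tb; have t0 := r0 t (ltW at') => /andP[d1 d2].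
  have dal : (t - a) / rho < alpha by rewrite -below_m.
  have := flatF t; rewrite at' tm dFE => /(_ isT) E.
  have [|||E'|E'] := @cos_eq_sym (alpha - (t - a) / rho) (th t - phi).
  - by clear -dal t0 alpi; apply/andP; split; lra.
  - by rewrite /phi; clear -d1 d2 alpi; apply/andP; split; lra.
  - by clear -E; lra.
  - by left; move: E'; rewrite /phi; clear; lra.
  - by right; move: E'; rewrite /phi => E'; clear -E' d2 alpi; split; lra.
split => // t tam.
have [//|[alphapi _]] := turn t tam.
have phiE : phi = th a - pi by rewrite /phi alphapi.
have cphi : cos phi = - cos (th a) by rewrite phiE cosB cospi sinpi; ring.
have sphi : sin phi = - sin (th a) by rewrite phiE sinB cospi sinpi; ring.
(* For alpha = pi, a left turn progresses along phi exactly as a right turn does, so the tie is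
   broken sideways: [Q] measures displacement to the right of the initial heading. It must gain 2 *
   rho before time m, and [H] shows that only the right arc does so. *)
pose Q t := sin (th a) * x t + (- cos (th a)) * y t + 0.
pose dQ t := sin (th a) * cos (th t) + (- cos (th a)) * sin (th t).
have dQd r : a <= r <= b -> is_derive r 1 Q (dQ r).
  by move=> rab; apply: is_derive_lincomb; [exact: dx|exact: dy].
have dQE r : dQ r = sin (th a - th r) by rewrite sinB /dQ; ring.
have Qmb : Q m = Q b.
  apply: (derive_eq0_eq mb (df := dQ)) => r rmb; first by apply: dQd; clear -rmb am; lra.
  by have [c s] := final r rmb; rewrite /dQ c s cphi sphi; ring.
have QbE : Q b - Q a = 2 * rho.
  rewrite /Q xb yb cphi sphi.
  transitivity (2 * rho * (cos (th a) ^+ 2 + sin (th a) ^+ 2)); first ring.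
  by rewrite cos2Dsin2 mulr1.
pose H t := (- rho) * cos (0 + rho^-1 * (t - a)) + (- 1) * Q t + 0.
pose dH t := (- rho) * (- (rho^-1 * sin (0 + rho^-1 * (t - a)))) + (- 1) * dQ t.
have dHd r : a <= r <= m -> is_derive r 1 H (dH r).
  move=> ram; apply: is_derive_lincomb; first exact: is_derive_cos_affine.
  by apply: dQd; clear -ram mb; lra.
have dHE r : dH r = sin ((r - a) / rho) - sin (th a - th r).
  rewrite /dH dQE mulN1r mulrN mulNr opprK mulrA mulfV ?gt_eqF // mul1r add0r.
  by rewrite [rho^-1 * _]mulrC.
have sin_pos r : a < r < m -> 0 < sin ((r - a) / rho).
  move=> /andP[ar rm]; apply: sin_gt0_pi; rewrite divr_gt0 ?subr_gt0 //=.
  by rewrite -alphapi -below_m.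
have dH0 r : a < r < m -> 0 <= dH r.
  move=> ram; rewrite dHE; have := sin_pos r ram.
  have [->|[_ ->]] := turn r ram.
    by rewrite (_ : th a - (th a - (r - a) / rho) = (r - a) / rho); [clear; lra|ring].
  rewrite (_ : th a - (th a + (r - a) / rho) = - ((r - a) / rho)); last ring.
  by rewrite sinN; clear; lra.
have Hma : H m <= H a.
  rewrite /H Qmb (_ : 0 + rho^-1 * (m - a) = pi); last first.
    by rewrite add0r mulrC mrho.
  by rewrite cospi subrr mulr0 !addr0 cos0; move: QbE; clear; lra.
have := derive_ge0_eq dHd dH0 Hma tam; rewrite dHE; have := sin_pos t tam.
have [//|[_ ->]] := turn t tam.
rewrite (_ : th a - (th a + (t - a) / rho) = - ((t - a) / rho)); last ring.
by rewrite sinN => s1 s2; exfalso; clear -s1 s2; lra.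
Qed.

End Calibration.

(** * Tangent paths in the moving frame and their half-angle parameter *)

Section Tangent.
Variable R : realType.
Implicit Types (rho a b X Y w : R) (th x y : R -> R).

Lemma derive_approx (f : R -> R) (df t : R) : is_derive t 1 f df ->
  forall e, 0 < e -> \forall s \near t, `|f s - f t - df * (s - t)| <= e * `|s - t|.
Proof.
move=> [fd <-] e e0.
have /cvgrPdist_le /(_ e e0) H := fd.
have : \forall h \near 0, h != 0 -> `|f (t + h) - f t - 'D_1 f t * h| <= e * `|h|.
  move: H; rewrite near_withinE; apply: filterS => h hh h0.
  have := hh h0.
  rewrite /= -[_ *: _]/(h^-1 * (f (h *: 1 + t) - f t)) (_ : h *: 1 + t = t + h); last first.
    by rewrite [h *: _]mulr1 addrC.
  rewrite distrC => H1.
  rewrite (_ : f (t + h) - f t - _ = (h^-1 * (f (t + h) - f t) - 'D_1 f t) * h); last first.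
    by rewrite mulrBl mulrAC mulVf ?mul1r.
  by rewrite normrM ler_wpM2r.
move=> H1.
have {}H1 : \forall h \near 0, `|f (t + h) - f t - 'D_1 f t * h| <= e * `|h|.
  apply: filterS H1 => h; have [->|h0] := eqVneq h 0; last exact.
  by rewrite addr0 subrr mulr0 subrr normr0 mulr0.
have /nbhs_ballP[d /= d0 dH] := H1.
near=> s.
have := dH (s - t); rewrite /ball /= sub0r normrN => /(_ _).
rewrite (_ : t + (s - t) = s); last by ring.
apply; near: s; exists d => //= s; rewrite /ball /=; by rewrite distrC.
Unshelve. all: by end_near. Qed.

Lemma sin_le_id (h : R) : 0 <= h -> sin h <= h.
Proof.
move=> h0.
have := @derive_ge0_le R (fun r : R => 1 * r + (- 1) * sin r + 0) (fun r : R => 1 * 1 + (- 1) * cos r) 0 h h0.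
rewrite sin0 => H; have : (1 * 0 + -1 * 0 + 0 <= 1 * h + -1 * sin h + 0) ; last lra.
apply: H => t _; first exact: is_derive_lincomb.
by have := cos_le1 t; lra.
Qed.

(** For h >= 0 the difference of the two sides has derivative k * sin t - (1 - cos t), and k >= t >=
    sin t gives k * sin t >= 1 - cos t ^+ 2 >= 1 - cos t as long as cos t >= 0. This lets a
    second-order gain absorb the third-order loss dl - sin dl. *)
Lemma subr_sin_le (k h : R) : `|h| <= k -> `|h| <= pi / 2 ->
  h - sin h <= k * (1 - cos h).
Proof.
have c1 := cos_le1 h; have [h0|h0] := leP 0 h; last first.
  rewrite ltr0_norm // => hk _.
  have := @sin_le_id (- h); rewrite sinN => /(_ ltac:(lra)) ?.
  have : 0 <= k * (1 - cos h) by apply: mulr_ge0; lra.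
  lra.
rewrite ger0_norm // => hk hpi.
have := @derive_ge0_le R (fun r : R => 1 * ((- k) * cos r + 1 * sin r + 0) + (- 1) * r + k)
   (fun r : R => 1 * ((- k) * (- sin r) + 1 * cos r) + (- 1) * 1) 0 h h0.
rewrite cos0 sin0 => H.
suff : 1 * (- k * 1 + 1 * 0 + 0) + -1 * 0 + k <= 1 * (- k * cos h + 1 * sin h + 0) + -1 * h + k by lra.
apply: H => t /andP[t0 th].
  by apply: is_derive_lincomb; exact: is_derive_lincomb.
have st : sin t <= t by apply: sin_le_id; lra.
have s0 : 0 <= sin t by apply: sin_ge0_pi; lra.
have c0 : 0 <= cos t by apply: cos_ge0_pihalf; lra.
have := cos2Dsin2 t; have := cos_le1 t; nra.
Qed.

(** Here w is the half-angle tangent tan ((alpha - pi) / 2). The angle thus depends continuously on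
    a quotient, without choice of branch, and its comparison with pi is the sign of w. *)
Definition arc_angle w : R := pi + 2 * atan w.

Lemma cos_arc_angle w : cos (arc_angle w) = - (1 - w ^+ 2) / (1 + w ^+ 2).
Proof.
have w1 : 0 < 1 + w ^+ 2 by have := sqr_ge0 w; lra.
rewrite /arc_angle cosD cospi sinpi mul0r subr0 mulrC mulrN1.
rewrite mulr_natl cos_mulr2n cos_atan exprVn sqr_sqrtr ?ltW //.
field; lra.
Qed.

Lemma sin_arc_angle w : sin (arc_angle w) = - (2 * w) / (1 + w ^+ 2).
Proof.
have w1 : 0 < 1 + w ^+ 2 by have := sqr_ge0 w; lra.
have c0 : cos (atan w) != 0 by rewrite cos_atan invr_neq0 // gt_eqF // sqrtr_gt0.
have -> : sin (arc_angle w) = - (2 * (cos (atan w) ^+ 2 * w)).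
  rewrite /arc_angle sinD cospi sinpi mul0r add0r mulN1r mulr_natl sin_mulr2n.
  have -> : sin (atan w) = w * cos (atan w).
    by rewrite -{2}(atanK w) /tan divfK.
  by rewrite -mulr_natl; ring.
rewrite cos_atan exprVn sqr_sqrtr ?ltW //.
by field; lra.
Qed.

Lemma arc_angle_bounds w : 0 < arc_angle w < 2 * pi.
Proof. by rewrite /arc_angle; have := atan_gtNpi2 w; have := atan_ltpi2 w; lra. Qed.

Lemma arc_angle_cos_lt1 w : cos (arc_angle w) < 1.
Proof.
have w1 : 0 < 1 + w ^+ 2 by have := sqr_ge0 w; lra.
by rewrite cos_arc_angle ltr_pdivrMr //; lra.
Qed.

(* (X, Y) = (to the right, ahead) are the coordinates of the end of the path R_alpha S,
   alpha = arc_angle w, with straight part d, in the frame of its initial configuration. *)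
Lemma RS_relative rho X Y d w :
  w * X = - (d + Y) -> w * (d - Y) = 2 * rho - X ->
  X = rho * (1 - cos (arc_angle w)) + d * sin (arc_angle w) /\
  Y = rho * sin (arc_angle w) + d * cos (arc_angle w).
Proof.
move=> wX wY; rewrite cos_arc_angle sin_arc_angle.
have w1 : 1 + w ^+ 2 != 0 by rewrite gt_eqF //; have := sqr_ge0 w; lra.
have E1 : (1 + w ^+ 2) * X = 2 * rho - 2 * d * w.
  transitivity (X + w * (w * X)); first ring.
  have XE : X = 2 * rho - w * (d - Y) by lra.
  by rewrite wX [in LHS]XE; ring.
have E2 : (1 + w ^+ 2) * Y = - 2 * rho * w - d * (1 - w ^+ 2).
  transitivity (Y + w ^+ 2 * d - w * (w * (d - Y))); first ring.
  rewrite wY; transitivity (Y + w ^+ 2 * d - 2 * rho * w + w * X); first ring.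
  by rewrite wX; ring.
split; apply: (mulfI w1); rewrite ?E1 ?E2; field; exact: w1.
Qed.

(* The power of the point (X, Y) with respect to the right-turning circle. *)
Definition circle_power rho X Y : R := X ^+ 2 + Y ^+ 2 - 2 * rho * X.

Definition tangent_length rho X Y : R := Num.sqrt (circle_power rho X Y).

Lemma tangent_length_sqr rho X Y : 0 <= circle_power rho X Y ->
  tangent_length rho X Y ^+ 2 = circle_power rho X Y.
Proof. exact: sqr_sqrtr. Qed.

End Tangent.

(** * Targets behind the pursuer *)

Section Growth.
Variable R : realType.
Implicit Types (rho a b X Y w : R) (th x y : R -> R).

Definition right_of th x y (q : R * R) t : R :=
  (q.1 - x t) * sin (th t) - (q.2 - y t) * cos (th t).

Definition ahead_of th x y (q : R * R) t : R :=
  (q.1 - x t) * cos (th t) + (q.2 - y t) * sin (th t).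

Lemma dubins_curveS rho a b a' b' th x y : a <= a' -> b' <= b ->
  dubins_curve rho a b th x y -> dubins_curve rho a' b' th x y.
Proof.
move=> aa bb [thL cth dx dy]; split.
- by move=> s t ? ? ?; apply: thL; lra.
- by move=> t ?; apply: cth; lra.
- by move=> t ?; apply: dx; lra.
- by move=> t ?; apply: dy; lra.
Qed.

Lemma continuous_trig th t : {for t, continuous th} ->
  {for t, continuous (fun r => cos (th r))} /\
  {for t, continuous (fun r => sin (th r))}.
Proof.
move=> cth; split.
- by apply: (@continuous_comp _ _ _ th cos); [exact: cth|exact: continuous_cos].
- by apply: (@continuous_comp _ _ _ th sin); [exact: cth|exact: continuous_sin].
Qed.

Lemma continuous_relative rho a b th x y q : dubins_curve rho a b th x y ->
  continuous_on a b (right_of th x y q) /\ continuous_on a b (ahead_of th x y q).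
Proof.
move=> [_ cth dx dy].
have cx := derive_continuous_on dx; have cy := derive_continuous_on dy.
split => t tab; have [cc cs] := continuous_trig (cth t tab).
- apply: continuousB; apply: continuousM => //; apply: continuousB;
    [exact: cvg_cst|exact: cx|exact: cvg_cst|exact: cy].
- apply: continuousD; apply: continuousM => //; apply: continuousB;
    [exact: cvg_cst|exact: cx|exact: cvg_cst|exact: cy].
Qed.

Lemma near_at_right (P : R -> Prop) t :
  (\forall s \near t, P s) -> \forall s \near t^'+, P s.
Proof. by move=> Pt; rewrite near_withinE; apply: filterS Pt. Qed.

Definition power_of rho th x y q t :=
  circle_power rho (right_of th x y q t) (ahead_of th x y q t).

Lemma continuous_power rho a b th x y q : dubins_curve rho a b th x y ->
  continuous_on a b (power_of rho th x y q).
Proof.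
move=> C t tab; have [cX cY] := continuous_relative q C.
apply: continuousB; last first.
  by apply: continuousM; [exact: cvg_cst|exact: cX].
by apply: continuousD; apply: continuousM; (exact: cX || exact: cY).
Qed.

(* The centre of the right-turning circle moves along the heading at speed 1 + u,
   hence away from q as long as q is not ahead. *)
Lemma behind_recedes rho a b th x y q : 0 < rho -> a <= b ->
  dubins_curve rho a b th x y ->
  (forall t, a <= t < b -> ahead_of th x y q t <= 0) ->
  power_of rho th x y q a <= power_of rho th x y q b.
Proof.
move=> rho0 ab C behind; have [thL cth dx dy] := C.
apply: dini_le => // [|t tab e e0]; first exact: continuous_power C.
have tab' : a <= t <= b by lra.
set X := right_of th x y q t; set Y := ahead_of th x y q t.
have Y0 : Y <= 0 by exact: behind.
(* ([E1], [E2]) points from the centre of the right-turning circle at time t to q; its squared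
   length is the power plus rho ^+ 2. *)
pose E1 := q.1 - x t - rho * sin (th t).
pose E2 := q.2 - y t + rho * cos (th t).
have EY : E1 * cos (th t) + E2 * sin (th t) = Y by rewrite /E1 /E2 /Y /ahead_of; ring.
have EX : E1 * sin (th t) - E2 * cos (th t) = X - rho.
  transitivity (X - rho * (cos (th t) ^+ 2 + sin (th t) ^+ 2)).
    by rewrite /E1 /E2 /X /right_of; ring.
  by rewrite cos2Dsin2 mulr1.
pose P r := E1 * x r + E2 * y r + 0.
have dP : is_derive t 1 P Y.
  by rewrite -EY; apply: is_derive_lincomb; [exact: dx|exact: dy].
(* The displacement of the centre, projected on ([E1], [E2]), is the increment of [P] plus rho times
   that of [K] at the turn h. The heading need not be differentiable, so [K] is expanded in h and
   |h| <= (r - t) / rho bounds the error. *)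
pose K h := (X - rho) * cos h + Y * sin h + 0.
have dK : is_derive (0 : R) 1 K Y.
  have -> : Y = (X - rho) * - sin 0 + Y * cos 0 by rewrite sin0 cos0; ring.
  exact: is_derive_lincomb.
have e4 : 0 < e / 4 by lra.
have aP := derive_approx dP e4.
have aK := derive_approx dK e4.
have {}aK : \forall r \near t, `|K (th r - th t) - K 0 - Y * (th r - th t - 0)| <= e / 4 * `|th r - th t - 0|.
  have c0 : (th r - th t) @[r --> t] --> 0.
    rewrite -(subrr (th t)); apply: cvgB; [exact: cth|exact: cvg_cst].
  exact: (c0 _ aK).
near=> r.
have tr : t < r by near: r; exact: nbhs_right_gt.
have rb : r <= b by near: r; apply: nbhs_right_le; lra.
have hth : `|th r - th t| <= (r - t) / rho.
  by apply: thL => //; exact: (andP tab).1.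
have HP : `|P r - P t - Y * (r - t)| <= e / 4 * `|r - t| by near: r; exact: near_at_right.
have HK : `|K (th r - th t) - K 0 - Y * (th r - th t - 0)| <= e / 4 * `|th r - th t - 0|.
  by near: r; exact: near_at_right.
set h := th r - th t in hth HK.
have thr : th r = th t + h by rewrite /h; ring.
have powE s : power_of rho th x y q s =
    (q.1 - x s - rho * sin (th s)) ^+ 2 + (q.2 - y s + rho * cos (th s)) ^+ 2 - rho ^+ 2.
  transitivity (((q.1 - x s) ^+ 2 + (q.2 - y s) ^+ 2) * (cos (th s) ^+ 2 + sin (th s) ^+ 2)
      - 2 * rho * right_of th x y q s); first by rewrite /power_of /circle_power /right_of /ahead_of; ring.
  rewrite cos2Dsin2 mulr1.
  transitivity ((q.1 - x s) ^+ 2 + (q.2 - y s) ^+ 2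
      - 2 * rho * right_of th x y q s + rho ^+ 2 * (cos (th s) ^+ 2 + sin (th s) ^+ 2) - rho ^+ 2).
    by rewrite cos2Dsin2; ring.
  by rewrite /right_of; ring.
pose C1 := x r - x t + rho * (sin (th r) - sin (th t)).
pose C2 := y r - y t - rho * (cos (th r) - cos (th t)).
have dotE : E1 * C1 + E2 * C2 = P r - P t + rho * (K h - K 0).
  have -> : K h = E1 * sin (th r) - E2 * cos (th r).
    by rewrite /K -EX -EY thr sinD cosD; ring.
  have -> : K 0 = E1 * sin (th t) - E2 * cos (th t) by rewrite /K cos0 sin0 EX; ring.
  by rewrite /P /C1 /C2; ring.
have powB : power_of rho th x y q r =
    power_of rho th x y q t - 2 * (E1 * C1 + E2 * C2) + (C1 ^+ 2 + C2 ^+ 2).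
  by rewrite !powE /E1 /E2 /C1 /C2; ring.
have C0 : 0 <= C1 ^+ 2 + C2 ^+ 2 by rewrite addr_ge0 ?sqr_ge0.
have rt0 : `|r - t| = r - t by rewrite ger0_norm // subr_ge0 ltW.
rewrite rt0 in HP; rewrite subr0 in HK.
have hrho : rho * `|h| <= r - t.
  by rewrite mulrC -ler_pdivlMr.
have P1 : P r - P t <= Y * (r - t) + e / 4 * (r - t).
  by rewrite -lerBlDl; exact: le_trans (ler_norm _) HP.
have K1 : K h - K 0 <= Y * h + e / 4 * `|h|.
  by rewrite -lerBlDl; exact: le_trans (ler_norm _) HK.
have K2 : rho * (K h - K 0) <= rho * (Y * h) + e / 4 * (rho * `|h|).
  have -> : rho * (Y * h) + e / 4 * (rho * `|h|) = rho * (Y * h + e / 4 * `|h|) by ring.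
  by rewrite ler_pM2l.
have K3 : e / 4 * (rho * `|h|) <= e / 4 * (r - t) by rewrite ler_pM2l.
have hge : - (rho * `|h|) <= rho * h.
  by rewrite -mulrN ler_pM2l // lerNl -normrN ler_norm.
have Ys : Y * (r - t) + rho * (Y * h) <= 0.
  have -> : Y * (r - t) + rho * (Y * h) = Y * (r - t + rho * h) by ring.
  by apply: (mulr_le0_ge0 Y0); clear -hge hrho; lra.
rewrite powB dotE; clear -P1 K2 K3 Ys C0; lra.
Unshelve. all: by end_near. Qed.

End Growth.

(** * Growth of elapsed time plus remaining length, and its equality case *)

Section Verification.
Variable R : realType.
Implicit Types (rho a b X Y w : R) (th x y : R -> R).

(** Where d ^+ 2 is the power of (X, Y), this quotient equals - (d + Y) / X, the one of
    [front_angle]. The present form is regular for Y < 0 even at X = 0, as needed when q crosses the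
    axis. *)
Definition behind_angle rho X Y : R :=
  arc_angle ((2 * rho - X) / (tangent_length rho X Y - Y)).

Definition behind_time rho X Y : R :=
  rho * behind_angle rho X Y + tangent_length rho X Y.

Lemma behind_relative rho X Y : Y < 0 -> 0 <= circle_power rho X Y ->
  let alpha := behind_angle rho X Y in
  let d := tangent_length rho X Y in
  X = rho * (1 - cos alpha) + d * sin alpha /\
  Y = rho * sin alpha + d * cos alpha.
Proof.
move=> Y0 pw; have d0 : 0 <= tangent_length rho X Y by exact: sqrtr_ge0.
have dE := tangent_length_sqr pw; set d := tangent_length rho X Y in d0 dE *.
have dY : d - Y != 0 by rewrite gt_eqF //; lra.
apply: RS_relative; last by rewrite divfK.
rewrite /behind_angle -/d; apply: (mulfI dY).
rewrite mulrA [_ * (_ / _)]mulrC divfK //.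
rewrite (_ : (d - Y) * - (d + Y) = Y ^+ 2 - d ^+ 2); last ring.
by rewrite dE /circle_power; ring.
Qed.

Lemma RS_world rho th x y q t alpha d :
  right_of th x y q t = rho * (1 - cos alpha) + d * sin alpha ->
  ahead_of th x y q t = rho * sin alpha + d * cos alpha ->
  q.1 = x t + rho * (sin (th t) - sin (th t - alpha)) + d * cos (th t - alpha) /\
  q.2 = y t + rho * (cos (th t - alpha) - cos (th t)) + d * sin (th t - alpha).
Proof.
move=> EX EY; rewrite sinB cosB.
have E1 : q.1 - x t = right_of th x y q t * sin (th t) + ahead_of th x y q t * cos (th t).
  transitivity ((q.1 - x t) * (cos (th t) ^+ 2 + sin (th t) ^+ 2)); last by rewrite /right_of /ahead_of; ring.
  by rewrite cos2Dsin2 mulr1.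
have E2 : q.2 - y t = ahead_of th x y q t * sin (th t) - right_of th x y q t * cos (th t).
  transitivity ((q.2 - y t) * (cos (th t) ^+ 2 + sin (th t) ^+ 2)); last by rewrite /right_of /ahead_of; ring.
  by rewrite cos2Dsin2 mulr1.
rewrite EX EY in E1 E2; split.
- by rewrite -[LHS](subrK (x t)) E1; ring.
- by rewrite -[LHS](subrK (y t)) E2; ring.
Qed.

(** This quantity is the integral of 1 + u: the deviation from a full right turn, zero only for that
    turn. *)
Lemma turn_ge0 rho a b th x y s t : 0 < rho -> dubins_curve rho a b th x y ->
  a <= s -> s <= t -> t <= b -> 0 <= t - s + rho * (th t - th s).
Proof.
move=> rho0 [thL _ _ _] as_ st tb.
have := thL s t as_ st tb; rewrite ler_norml => /andP[+ _].
rewrite -mulNr ler_pdivrMr // opprB => H.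
by rewrite mulrC; lra.
Qed.

Section Along.
Variables (rho a b : R) (th x y : R -> R) (q : R * R).
Hypotheses (rho0 : 0 < rho) (ab : a <= b) (C : dubins_curve rho a b th x y).
Hypothesis behind : forall t, a <= t <= b ->
  ahead_of th x y q t < 0 /\ 0 < power_of rho th x y q t.

Let d t := tangent_length rho (right_of th x y q t) (ahead_of th x y q t).
Let al t := behind_angle rho (right_of th x y q t) (ahead_of th x y q t).
Let phi t := th t - al t.

Let d_gt0 t : a <= t <= b -> 0 < d t.
Proof. by move=> /behind[_ pw]; rewrite sqrtr_gt0. Qed.

Let continuous_d : continuous_on a b d.
Proof.
move=> t tab; apply: (@continuous_comp _ _ _ (power_of rho th x y q) Num.sqrt).
  exact: (continuous_power C).
exact: sqrt_continuous.
Qed.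

Let continuous_al : continuous_on a b al.
Proof.
move=> t tab; have [cX cY] := continuous_relative q C.
apply: continuousD; first exact: cvg_cst.
apply: continuousM; first exact: cvg_cst.
apply: (@continuous_comp _ _ _ (fun r => (2 * rho - right_of th x y q r) / (d r - ahead_of th x y q r)) atan).
  apply: continuousM.
    by apply: continuousB; [exact: cvg_cst|exact: cX].
  apply: continuousV; last by apply: continuousB; [exact: continuous_d|exact: cY].
  by rewrite gt_eqF //; have := d_gt0 tab; have [? _] := behind tab; lra.
exact: continuous_atan.
Qed.

Let world t : a <= t <= b ->
  q.1 = x t + rho * (sin (th t) - sin (phi t)) + d t * cos (phi t) /\
  q.2 = y t + rho * (cos (phi t) - cos (th t)) + d t * sin (phi t).
Proof.
move=> tab; have [Y0 pw] := behind tab.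
by have [EX EY] := behind_relative Y0 (ltW pw); exact: RS_world EX EY.
Qed.

Let f t := t + behind_time rho (right_of th x y q t) (ahead_of th x y q t).

(* phi is the final heading of the path R S to q. For dl = phi r - phi t the
   increment of f is, up to o(r - t), (1 - cos al) (r - t + rho (th r - th t))
   + d (1 - cos dl) - rho (dl - sin dl), whose last two terms are together
   nonnegative for small dl. *)
Lemma behind_time_local_growth t e : a <= t < b -> 0 < e ->
  \forall r \near t^'+,
    f t + (1 - cos (al t)) * (r - t + rho * (th r - th t)) - e * (r - t) <= f r.
Proof.
move=> tab e0; have [thL cth dx dy] := C.
have tab' : a <= t <= b by lra.
have dt0 := d_gt0 tab'.
pose P r := cos (phi t) * x r + sin (phi t) * y r + 0.
have dP : is_derive t 1 P (cos (al t)).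
  have -> : al t = th t - phi t by rewrite /phi; ring.
  by rewrite cosB mulrC [X in _ + X]mulrC; apply: is_derive_lincomb; [exact: dx|exact: dy].
have e2 : 0 < e / 2 by lra.
have aP := derive_approx dP e2.
have aS := derive_approx (is_derive_sin (al t)) e2.
have {}aS : \forall r \near t, `|sin (al t + (th r - th t)) - sin (al t) - cos (al t) * (al t + (th r - th t) - al t)|
     <= e / 2 * `|al t + (th r - th t) - al t|.
  have c0 : (al t + (th r - th t)) @[r --> t] --> al t.
    rewrite -[X in _ --> X]addr0 -(subrr (th t)).
    by apply: cvgD; [exact: cvg_cst|apply: cvgB; [exact: cth|exact: cvg_cst]].
  exact: (c0 _ aS).
(* These are the bounds required by [subr_sin_le] with k = d t / (2 * rho); only half of d t is
   available because d r is merely kept above d t / 2. *)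
have kpos : 0 < Num.min (d t / (2 * rho)) (pi / 2).
  rewrite lt_min; apply/andP; split; apply: divr_gt0 => //; last exact: pi_gt0.
  by rewrite mulr_gt0.
have cphi : {for t, continuous phi}.
  by apply: continuousB; [exact: cth|exact: continuous_al].
have aphi : \forall r \near t, `|phi t - phi r| <= Num.min (d t / (2 * rho)) (pi / 2).
  by have /cvgrPdist_le := cphi; apply.
have ad : \forall r \near t, d t / 2 < d r.
  by apply: (cvgr_gt _ (continuous_d tab')); lra.
near=> r.
have tr : t < r by near: r; exact: nbhs_right_gt.
have rb : r <= b by near: r; apply: nbhs_right_le; lra.
have rab : a <= r <= b by lra.
have hth : `|th r - th t| <= (r - t) / rho.
  by apply: thL => //; exact: (andP tab).1.
have HP : `|P r - P t - cos (al t) * (r - t)| <= e / 2 * `|r - t|.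
  by near: r; exact: near_at_right.
have HS : `|sin (al t + (th r - th t)) - sin (al t) - cos (al t) * (al t + (th r - th t) - al t)|
     <= e / 2 * `|al t + (th r - th t) - al t| by near: r; exact: near_at_right.
have Hphi : `|phi t - phi r| <= Num.min (d t / (2 * rho)) (pi / 2).
  by near: r; exact: near_at_right.
have Hd : d t / 2 < d r by near: r; exact: near_at_right.
move: HS; rewrite (_ : al t + (th r - th t) - al t = th r - th t); last ring.
set h := th r - th t in hth * => HS.
pose dl := phi r - phi t.
move: Hphi; rewrite distrC -/dl le_min => /andP[dl1 dl2].
(* The two instances of [world] describe the same q; their difference, projected on the direction
   phi t, trades the displacement for the changes of d and phi. *)
have PrE : P r - P t = rho * (sin dl - sin (al t + h) + sin (al t)) + d t - d r * cos dl.
  have [w1 w2] := world rab; have [w3 w4] := world tab'.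
  have sal : sin (al t) = sin (th t) * cos (phi t) - cos (th t) * sin (phi t).
    by rewrite -sinB; congr sin; rewrite /phi; ring.
  have salh : sin (al t + h) = sin (th r) * cos (phi t) - cos (th r) * sin (phi t).
    by rewrite -sinB; congr sin; rewrite /phi /h; ring.
  rewrite sal salh /dl sinB cosB /P.
  have -> : x r = q.1 - rho * (sin (th r) - sin (phi r)) - d r * cos (phi r) by rewrite w1; ring.
  have -> : y r = q.2 - rho * (cos (phi r) - cos (th r)) - d r * sin (phi r) by rewrite w2; ring.
  have -> : x t = q.1 - rho * (sin (th t) - sin (phi t)) - d t * cos (phi t) by rewrite w3; ring.
  have -> : y t = q.2 - rho * (cos (phi t) - cos (th t)) - d t * sin (phi t) by rewrite w4; ring.
  rewrite -[X in _ = _ + X - _](mulr1 (d t)) -(cos2Dsin2 (phi t)); ring.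
have fE : f r - f t = (r - t) + rho * (h - dl) + (d r - d t).
  by rewrite /f /behind_time -/(d r) -/(d t) -/(al r) -/(al t) /dl /phi /h; ring.
have sd : rho * (dl - sin dl) <= d r * (1 - cos dl).
  apply: (@le_trans _ _ (d t / 2 * (1 - cos dl))).
    rewrite (_ : d t / 2 = rho * (d t / (2 * rho))); last by field; rewrite gt_eqF.
    by rewrite -mulrA ler_pM2l //; exact: subr_sin_le.
  by apply: ler_wpM2r (ltW Hd); rewrite subr_ge0 cos_le1.
have rt0 : `|r - t| = r - t by rewrite ger0_norm // subr_ge0 ltW.
rewrite rt0 in HP.
have hrho : rho * `|h| <= r - t by rewrite mulrC -ler_pdivlMr.
have P1 : P r - P t <= cos (al t) * (r - t) + e / 2 * (r - t).
  by rewrite -lerBlDl; exact: le_trans (ler_norm _) HP.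
have S1 : sin (al t + h) - sin (al t) <= cos (al t) * h + e / 2 * `|h|.
  by rewrite -lerBlDl; exact: le_trans (ler_norm _) HS.
have S2 : rho * (sin (al t + h) - sin (al t)) <= rho * (cos (al t) * h) + e / 2 * (rho * `|h|).
  have -> : rho * (cos (al t) * h) + e / 2 * (rho * `|h|) = rho * (cos (al t) * h + e / 2 * `|h|) by ring.
  by rewrite ler_pM2l.
have S3 : e / 2 * (rho * `|h|) <= e / 2 * (r - t) by rewrite ler_pM2l.
rewrite -lerBrDl.
have -> : f r = f t + (f r - f t) by ring.
rewrite fE; move: PrE sd P1 S2 S3; clear; move=> PrE sd P1 S2 S3.
lra.
Unshelve. all: by end_near. Qed.

Lemma behind_time_growth : f a <= f b.
Proof.
apply: dini_le => // [t tab|t tab e e0].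
  apply: continuousD; first exact: cvg_id.
  apply: continuousD; last exact: continuous_d.
  by apply: continuousM; [exact: cvg_cst|exact: continuous_al].
near=> r.
have tr : t < r by near: r; exact: nbhs_right_gt.
have rb : r <= b by near: r; apply: nbhs_right_le; lra.
have H : f t + (1 - cos (al t)) * (r - t + rho * (th r - th t)) - e * (r - t) <= f r.
  by near: r; exact: behind_time_local_growth.
apply: le_trans H; rewrite lerD2r lerDl.
by apply: mulr_ge0; [rewrite subr_ge0 cos_le1|apply: (turn_ge0 rho0 C); lra].
Unshelve. all: by end_near. Qed.

End Along.

(** When f is constant, its local growth bounds (1 - cos al) times the increment of t + rho * th by
    an arbitrarily small multiple of the elapsed time. Since cos al < 1, taking the slack (1 - cos
    al) * e lets the factor cancel, so t + rho * th is nonincreasing; by [turn_ge0] it is also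
    nondecreasing. *)
Lemma behind_time_rigid rho a b th x y q : 0 < rho -> a <= b ->
  dubins_curve rho a b th x y ->
  (forall t, a <= t <= b ->
     ahead_of th x y q t < 0 /\ 0 < power_of rho th x y q t) ->
  let f t := t + behind_time rho (right_of th x y q t) (ahead_of th x y q t) in
  f b <= f a -> forall t, a <= t <= b -> th t = th a - (t - a) / rho.
Proof.
move=> rho0 ab C behind f fba t tab; have [_ cth _ _] := C.
have mono r s : a <= r -> r <= s -> s <= b -> f r <= f s.
  move=> ar rs sb; apply: (@behind_time_growth rho r s th x y q) => //.
    exact: (dubins_curveS ar sb C).
  by move=> z rz; apply: behind; lra.
have cst s : a <= s <= b -> f s = f a.
  move=> /andP[as_ sb]; apply/le_anti; rewrite (mono a s) // andbT.
  exact: le_trans (mono s b as_ sb (lexx b)) fba.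
suff : t + rho * th t <= a + rho * th a.
  move=> le1; have le2 := turn_ge0 (s := a) (t := t) rho0 C ltac:(lra) ltac:(lra) ltac:(lra).
  apply: (mulfI (x := rho)); first by rewrite gt_eqF.
  rewrite mulrBr [rho * (_ / _)]mulrC divfK ?gt_eqF //; lra.
suff : - (a + rho * th a) <= - (t + rho * th t) by lra.
apply: (@dini_le _ (fun r => - (r + rho * th r))) => [|r rab|r rab e e0]; first lra.
  apply: continuousN; apply: continuousD; first exact: cvg_id.
  by apply: continuousM; [exact: cvg_cst|apply: cth; lra].
pose al := behind_angle rho (right_of th x y q r) (ahead_of th x y q r).
have k0 : 0 < 1 - cos al by rewrite subr_gt0; exact: arc_angle_cos_lt1.
have ke : 0 < (1 - cos al) * e by exact: mulr_gt0.
have rab' : a <= r < b by lra.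
have loc := behind_time_local_growth rho0 C behind rab' ke.
near=> s.
have rs : r < s by near: s; exact: nbhs_right_gt.
have st : s <= t by near: s; apply: nbhs_right_le; lra.
have : f r + (1 - cos al) * (s - r + rho * (th s - th r)) - (1 - cos al) * e * (s - r) <= f s.
  by near: s; exact: loc.
rewrite (cst r) ?(cst s); try (clear -rab rs st tab; lra).
rewrite -addrA gerDl -mulrA -mulrBr pmulr_rle0 // => H; lra.
Unshelve. all: by end_near. Qed.

End Verification.

(** * Optimality of R_alpha S *)

Section Optimality.
Variable R : realType.
Implicit Types (rho a b X Y w : R) (th x y : R -> R) (q : R * R).

Lemma arc_position rho a b th x y kappa c : a <= b -> kappa != 0 ->
  dubins_curve rho a b th x y ->
  (forall t, a < t < b -> th t = c + kappa * (t - a)) ->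
  x b = x a + kappa^-1 * (sin (c + kappa * (b - a)) - sin c) /\
  y b = y a - kappa^-1 * (cos (c + kappa * (b - a)) - cos c).
Proof.
move=> ab k0 [_ _ dx dy] E.
pose F t := 1 * x t + (- kappa^-1) * sin (c + kappa * (t - a)) + 0.
pose G t := 1 * y t + kappa^-1 * cos (c + kappa * (t - a)) + 0.
have FF : F a = F b.
  apply: (derive_eq0_eq ab (df := fun t => 1 * cos (th t) + (- kappa^-1) * (kappa * cos (c + kappa * (t - a))))).
    move=> t tab; apply: is_derive_lincomb; first exact: dx.
    exact: is_derive_sin_affine.
  by move=> t tab; rewrite E // mulrA mulNr mulVf //; ring.
have GG : G a = G b.
  apply: (derive_eq0_eq ab (df := fun t => 1 * sin (th t) + kappa^-1 * - (kappa * sin (c + kappa * (t - a))))).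
    move=> t tab; apply: is_derive_lincomb; first exact: dy.
    exact: is_derive_cos_affine.
  by move=> t tab; rewrite E // mulrN mulrA mulVf //; ring.
move: FF GG; rewrite /F /G subrr mulr0 !addr0 => FF GG.
split; [move: FF|move: GG]; rewrite mulrBr; lra.
Qed.

Lemma straight_position rho a b th x y c s : a <= b ->
  dubins_curve rho a b th x y ->
  (forall t, a < t < b -> cos (th t) = c /\ sin (th t) = s) ->
  x b = x a + (b - a) * c /\ y b = y a + (b - a) * s.
Proof.
move=> ab [_ _ dx dy] E.
have FF : 1 * x a + (- c) * a + 0 = 1 * x b + (- c) * b + 0.
  apply: (derive_eq0_eq (f := fun t => 1 * x t + (- c) * t + 0) ab (df := fun t => 1 * cos (th t) + (- c) * 1)).
    by move=> t tab; apply: is_derive_lincomb; exact: dx.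
  by move=> t /E[-> _]; ring.
have GG : 1 * y a + (- s) * a + 0 = 1 * y b + (- s) * b + 0.
  apply: (derive_eq0_eq (f := fun t => 1 * y t + (- s) * t + 0) ab (df := fun t => 1 * sin (th t) + (- s) * 1)).
    by move=> t tab; apply: is_derive_lincomb; exact: dy.
  by move=> t /E[_ ->]; ring.
split; rewrite mulrBl; lra.
Qed.

(** Reflection in the line x = 0 exchanges left and right turns, so results on the right-turning
    circle transfer to the left one. *)
Lemma dubins_curve_reflect rho a b th x y : dubins_curve rho a b th x y ->
  dubins_curve rho a b (fun t => pi - th t) (fun t => - x t) y.
Proof.
move=> [thL cth dx dy]; split.
- move=> s t as_ st tb; rewrite (_ : pi - th t - (pi - th s) = - (th t - th s)); last ring.
  by rewrite normrN; exact: thL.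
- by move=> t tab; apply: continuousB; [exact: cvg_cst|exact: cth].
- move=> t tab; rewrite cosB cospi sinpi mul0r addr0 mulN1r.
  by apply: is_deriveN; exact: dx.
- by move=> t tab; rewrite sinB cospi sinpi mul0r sub0r mulN1r opprK; exact: dy.
Qed.

Lemma relative_reflect th x y q t :
  right_of (fun t => pi - th t) (fun t => - x t) y (- q.1, q.2) t = - right_of th x y q t /\
  ahead_of (fun t => pi - th t) (fun t => - x t) y (- q.1, q.2) t = ahead_of th x y q t.
Proof.
by rewrite /right_of /ahead_of /= sinB cosB cospi sinpi; split; ring.
Qed.

Definition front_angle rho X Y : R :=
  arc_angle (- (tangent_length rho X Y + Y) / X).

Definition front_time rho X Y : R :=
  rho * front_angle rho X Y + tangent_length rho X Y.

Lemma front_relative rho X Y : 0 < X -> 0 <= circle_power rho X Y ->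
  let alpha := front_angle rho X Y in
  let d := tangent_length rho X Y in
  X = rho * (1 - cos alpha) + d * sin alpha /\
  Y = rho * sin alpha + d * cos alpha.
Proof.
move=> X0 pw; have dE := tangent_length_sqr pw.
rewrite /front_angle; set d := tangent_length rho X Y in dE *.
have Xn0 : X != 0 by rewrite gt_eqF.
apply: RS_relative; first by rewrite divfK.
apply: (mulfI Xn0); rewrite mulrCA mulrA divfK // mulNr.
rewrite (_ : - ((d + Y) * (d - Y)) = Y ^+ 2 - d ^+ 2); last ring.
by rewrite dE /circle_power; ring.
Qed.

Lemma front_behind_time rho X Y : 0 < X -> Y < 0 -> 0 <= circle_power rho X Y ->
  front_time rho X Y = behind_time rho X Y.
Proof.
move=> X0 Y0 pw; have dE := tangent_length_sqr pw.
have d0 : 0 <= tangent_length rho X Y by exact: sqrtr_ge0.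
rewrite /front_time /behind_time /front_angle /behind_angle.
set d := tangent_length rho X Y in d0 dE *.
congr (_ * arc_angle _ + _).
apply/eqP; rewrite eqr_div; try by rewrite gt_eqF //; lra.
apply/eqP; rewrite (_ : - (d + Y) * (d - Y) = Y ^+ 2 - d ^+ 2); last ring.
by rewrite dE /circle_power; ring.
Qed.

Lemma front_angle_le_pi rho X Y : 0 < X -> 0 <= tangent_length rho X Y + Y ->
  front_angle rho X Y <= pi.
Proof.
move=> X0 dY; rewrite /front_angle /arc_angle gerDl pmulr_rle0 // -(@atan0 R).
by apply: le_atan; rewrite mulNr oppr_le0 divr_ge0 // ltW.
Qed.

Lemma behind_half_turn rho Y : Y < 0 ->
  tangent_length rho (2 * rho) Y = - Y /\ behind_angle rho (2 * rho) Y = pi.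
Proof.
move=> Y0; have -> : behind_angle rho (2 * rho) Y = pi.
  by rewrite /behind_angle subrr mul0r /arc_angle atan0 mulr0 addr0.
split=> //; rewrite /tangent_length /circle_power.
rewrite (_ : _ - _ = Y ^+ 2); last ring.
by rewrite sqrtr_sqr ltr0_norm.
Qed.

(** The form in which calibration delivers the path: equality of derivatives holds on open
    intervals, and the final heading is determined only modulo 2 pi, hence through its cosine and
    sine. *)
Definition RS_motion rho a b th (alpha d : R) : Prop :=
  [/\ b = a + rho * alpha + d,
      forall t, a < t < a + rho * alpha -> th t = th a - (t - a) / rho
    & forall t, a + rho * alpha < t < b ->
        cos (th t) = cos (th a - alpha) /\ sin (th t) = sin (th a - alpha)].

Lemma RS_calibration_relative rho a b th x y q alpha d :
  0 < rho -> a < b -> dubins_curve rho a b th x y ->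
  x b = q.1 -> y b = q.2 -> 0 <= alpha <= pi -> 0 <= d ->
  right_of th x y q a = rho * (1 - cos alpha) + d * sin alpha ->
  ahead_of th x y q a = rho * sin alpha + d * cos alpha ->
  b - a <= rho * alpha + d ->
  RS_motion rho a b th alpha d.
Proof.
move=> rho0 ab C xb yb al0 d0 EX EY le.
have [w1 w2] := RS_world EX EY.
apply: (RS_calibration rho0 ab C al0 d0) => //; first by rewrite xb.
by rewrite yb.
Qed.

Lemma power_reflect rho th x y q t :
  power_of rho (fun t => pi - th t) (fun t => - x t) y (- q.1, q.2) t =
  circle_power rho (- right_of th x y q t) (ahead_of th x y q t).
Proof. by rewrite /power_of !(relative_reflect th x y q t).1 (relative_reflect th x y q t).2. Qed.

(* With Y = 0 the point can be outside both turning circles only if X > 2 rho or X < - 2 rho. *)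
Lemma behind_until rho a b th x y q : 0 < rho ->
  dubins_curve rho a b th x y ->
  ahead_of th x y q a < 0 -> 0 < power_of rho th x y q a ->
  0 < circle_power rho (- right_of th x y q a) (ahead_of th x y q a) ->
  (forall t, a <= t <= b -> right_of th x y q t ^+ 2 <= 4 * rho ^+ 2) ->
  forall t, a <= t <= b ->
    [/\ ahead_of th x y q t < 0, 0 < power_of rho th x y q t
      & 0 < circle_power rho (- right_of th x y q t) (ahead_of th x y q t)].
Proof.
move=> rho0 C Ya Na La strip.
have powers t : a <= t <= b -> (forall s, a <= s < t -> ahead_of th x y q s < 0) ->
    0 < power_of rho th x y q t /\
    0 < circle_power rho (- right_of th x y q t) (ahead_of th x y q t).
  move=> /andP[at' tb] behind.
  have Ct := dubins_curveS (lexx a) tb C.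
  split.
    apply: lt_le_trans Na _; apply: (behind_recedes rho0 at' Ct) => s /behind; exact: ltW.
  apply: lt_le_trans La _; rewrite -!power_reflect.
  apply: (behind_recedes rho0 at' (dubins_curve_reflect Ct)) => s /behind.
  by rewrite (relative_reflect th x y q s).2 => /ltW.
have behind t : a <= t <= b -> ahead_of th x y q t < 0.
  move=> /andP[at' tb]; rewrite ltNge; apply/negP => Yt.
  have [_ cY] := continuous_relative q (dubins_curveS (lexx a) tb C).
  have [s [as_ st Ys below]] := first_hit at' cY Ya Yt.
  have sab : a <= s <= b by lra.
  have [] := powers s sab below; have := strip s sab.
  rewrite /power_of /circle_power Ys; set X := right_of th x y q s => X2 P1 P2.
  have P3 : 0 < X * (X - 2 * rho) by lra.
  have P4 : 0 < X * (X + 2 * rho) by lra.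
  have P5 : 0 < X ^+ 2 * (X ^+ 2 - 4 * rho ^+ 2).
    by rewrite (_ : _ * _ = X * (X - 2 * rho) * (X * (X + 2 * rho))); [exact: mulr_gt0|ring].
  have P6 : X ^+ 2 * (X ^+ 2 - 4 * rho ^+ 2) <= 0.
    by apply: mulr_ge0_le0; [exact: sqr_ge0|lra].
  lra.
move=> t tab; have [] := powers t tab; last by split=> //; exact: behind.
by move=> s sat; apply: behind; lra.
Qed.

Lemma half_turn_calibration rho a b th x y q :
  0 < rho -> a <= b -> dubins_curve rho a b th x y ->
  x b = q.1 -> y b = q.2 ->
  right_of th x y q a = 2 * rho -> ahead_of th x y q a < 0 ->
  b - a <= rho * pi - ahead_of th x y q a ->
  RS_motion rho a b th pi (- ahead_of th x y q a).
Proof.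
move=> rho0 ab C xb yb X Y0 le.
apply: (RS_calibration_relative (x := x) (y := y) (q := q)) => //.
- rewrite lt_neqAle ab andbT; apply/eqP => E; move: Y0.
  by rewrite /ahead_of E xb yb !subrr !mul0r addr0 ltxx.
- by rewrite lexx pi_ge0.
- lra.
- by rewrite X cospi sinpi; ring.
- by rewrite cospi sinpi; ring.
Qed.

(** During a right turn the centre of the circle stays fixed, so in the moving frame q rotates about
    (rho, 0) by the angle t / rho. *)
Lemma right_arc_relative rho b th x y q t : 0 < rho ->
  dubins_curve rho 0 b th x y -> x 0 = 0 -> y 0 = 0 ->
  (forall s, 0 <= s <= b -> th s = pi / 2 - s / rho) -> 0 <= t <= b ->
  right_of th x y q t = rho + (q.1 - rho) * cos (t / rho) - q.2 * sin (t / rho) /\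
  ahead_of th x y q t = (q.1 - rho) * sin (t / rho) + q.2 * cos (t / rho).
Proof.
move=> rho0 C x0 y0 turn /andP[t0 tb].
have rn0 : - rho^-1 != 0 by rewrite oppr_eq0 invr_neq0 // gt_eqF.
have [] := arc_position (c := pi / 2) t0 rn0 (dubins_curveS (lexx 0) tb C).
  by move=> s s0t; rewrite turn ?subr0 ?mulNr 1?mulrC //; lra.
have E : pi / 2 + - rho^-1 * (t - 0) = pi / 2 - t / rho by rewrite subr0 mulNr [rho^-1 * _]mulrC.
have thE : th t = pi / 2 - t / rho by rewrite turn // t0.
rewrite E x0 y0 invrN invrK !cosB !sinB cos_pihalf sin_pihalf => xE yE.
rewrite /right_of /ahead_of thE xE yE !cosB !sinB cos_pihalf sin_pihalf.
set c := cos _; set s := sin _; have cs : c ^+ 2 + s ^+ 2 = 1 by exact: cos2Dsin2.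
split; last by ring.
transitivity (rho * (c ^+ 2 + s ^+ 2) + (q.1 - rho) * c - q.2 * s); first by ring.
by rewrite cs mulr1.
Qed.

Lemma RS_optimal rho T th x y q :
  0 < rho -> 0 < T -> dubins_curve rho 0 T th x y ->
  th 0 = pi / 2 -> x 0 = 0 -> y 0 = 0 -> x T = q.1 -> y T = q.2 ->
  0 < q.1 -> 0 < circle_power rho q.1 q.2 -> 0 < circle_power rho (- q.1) q.2 ->
  T <= front_time rho q.1 q.2 ->
  exists alpha d, [/\ 0 <= alpha <= 2 * pi, 0 <= d & RS_motion rho 0 T th alpha d].
Proof.
move=> rho0 T0 C th0 x0 y0 xT yT q10 Npos Lpos Tle.
have right0 : right_of th x y q 0 = q.1.
  by rewrite /right_of th0 x0 y0 sin_pihalf cos_pihalf; ring.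
have ahead0 : ahead_of th x y q 0 = q.2.
  by rewrite /ahead_of th0 x0 y0 sin_pihalf cos_pihalf; ring.
have dge0 : 0 <= tangent_length rho q.1 q.2 by exact: sqrtr_ge0.
have /andP[al0 al2] := arc_angle_bounds (- (tangent_length rho q.1 q.2 + q.2) / q.1).
(* For q.1 > 0 the sign of d + Y decides whether alpha <= pi. *)
have [dq|dq] := leP 0 (tangent_length rho q.1 q.2 + q.2).
  have [EX EY] := front_relative q10 (ltW Npos).
  exists (front_angle rho q.1 q.2), (tangent_length rho q.1 q.2); split => //.
    by rewrite !ltW.
  apply: (RS_calibration_relative (x := x) (y := y) (q := q)) => //.
  - by rewrite ltW //= front_angle_le_pi.
  - by rewrite right0.
  - by rewrite ahead0.
  - by rewrite subr0.
have q20 : q.2 < 0 by lra.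
have dE := tangent_length_sqr (ltW Npos).
have q12 : q.1 < 2 * rho.
  have : tangent_length rho q.1 q.2 ^+ 2 < q.2 ^+ 2.
    by rewrite -[ltRHS]sqrrN ltr_pXn2r // ?nnegrE; lra.
  rewrite dE /circle_power => H; rewrite -(ltr_pM2l q10); lra.
have a0 : ahead_of th x y q 0 < 0 by rewrite ahead0.
have N0 : 0 < power_of rho th x y q 0 by rewrite /power_of right0 ahead0.
have L0 : 0 < circle_power rho (- right_of th x y q 0) (ahead_of th x y q 0).
  by rewrite right0 ahead0.
have [cX cY] := continuous_relative q C.
(* At time T, q is at the origin of the moving frame; had it stayed in the strip, [behind_until]
   would still place it strictly behind. *)
have [t1 [t10 t1T X1]] : exists t, [/\ 0 <= t, t <= T & 4 * rho ^+ 2 <= right_of th x y q t ^+ 2].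
  apply/not_existsP => H.
  have strip t : 0 <= t <= T -> right_of th x y q t ^+ 2 <= 4 * rho ^+ 2.
    move=> /andP[t0 tT]; rewrite leNgt; apply/negP => Ht; apply: (H t); split=> //.
    exact: ltW.
  have [] := behind_until rho0 C a0 N0 L0 strip (t := T); first by rewrite ltW //= lexx.
  by rewrite /ahead_of xT yT !subrr !mul0r addr0 ltxx.
have cX2 : continuous_on 0 t1 (fun t => right_of th x y q t ^+ 2).
  by move=> t t01; apply: continuousM; apply: cX; clear -t01 t1T; lra.
have X0 : right_of th x y q 0 ^+ 2 < 4 * rho ^+ 2.
  rewrite right0 (_ : 4 * rho ^+ 2 = (2 * rho) ^+ 2); last ring.
  by rewrite ltr_pXn2r // nnegrE; lra.
have [tau [tau0 taut1 Xtau below]] := first_hit t10 cX2 X0 X1.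
have tauT : tau <= T by lra.
have C1 := dubins_curveS (lexx 0) tauT C.
have C2 := dubins_curveS (ltW tau0) (lexx T) C.
have strip t : 0 <= t <= tau -> right_of th x y q t ^+ 2 <= 4 * rho ^+ 2.
  move=> /andP[t0 tt]; have [->|ne] := eqVneq t tau; first by rewrite Xtau.
  by apply/ltW/below; rewrite t0 lt_neqAle ne.
have behind := behind_until rho0 C1 a0 N0 L0 strip.
have Btau : 0 <= tau <= tau by rewrite ltW // lexx.
have [Ytau _ _] := behind tau Btau.
have front0 : front_time rho q.1 q.2 = behind_time rho (right_of th x y q 0) (ahead_of th x y q 0).
  by rewrite right0 ahead0; apply: front_behind_time => //; exact: ltW.
(* If q leaves the strip on the left, it first crosses the axis X = 0, where
   right and left tangent paths have the same length. *)
have [E|E] : right_of th x y q tau = 2 * rho \/ right_of th x y q tau = - (2 * rho).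
  have : (right_of th x y q tau - 2 * rho) * (right_of th x y q tau + 2 * rho) = 0.
    by rewrite (_ : _ * _ = right_of th x y q tau ^+ 2 - 4 * rho ^+ 2); [rewrite Xtau subrr|ring].
  by move=> /eqP; rewrite mulf_eq0 => /orP[/eqP|/eqP] H; clear -H; [left|right]; lra.
- have behindR t : 0 <= t <= tau -> ahead_of th x y q t < 0 /\ 0 < power_of rho th x y q t.
    by move=> /behind[].
  have [dtau altau] := behind_half_turn rho Ytau.
  have growth := behind_time_growth rho0 (ltW tau0) C1 behindR.
  move: growth; rewrite -front0 E /behind_time dtau altau add0r => growth.
  (* T is at most the initial V, itself at most tau + rho * pi - Y at tau. Calibration of the
     remaining half turn makes both equalities, and the equality [Tau] is what rigidity on [0, tau]
     needs. *)
  have [Tau turn2 straight2] : RS_motion rho tau T th pi (- ahead_of th x y q tau).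
    by apply: (half_turn_calibration (x := x) (y := y)) => //; clear -growth Tle; lra.
  have turn1 : forall t, 0 <= t <= tau -> th t = th 0 - (t - 0) / rho.
    apply: (behind_time_rigid rho0 (ltW tau0) C1 behindR).
    by rewrite -front0 E /behind_time dtau altau add0r; clear -Tau Tle; lra.
  have {}turn1 t : 0 <= t <= tau -> th t = pi / 2 - t / rho by move=> /turn1; rewrite subr0 th0.
  (* A right turn by exactly pi would change the ahead coordinate from q.2 to - q.2 > 0, although q
     is still behind. This gives alpha <= 2 pi. *)
  have taupi : tau / rho <= pi.
    rewrite leNgt; apply/negP => tp.
    have tp' : pi * rho < tau by rewrite -ltr_pdivlMr.
    have tp0 : 0 <= pi * rho <= tau by rewrite mulr_ge0 ?pi_ge0 ?(ltW rho0) //= ltW.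
    have [_] := right_arc_relative q rho0 C1 x0 y0 turn1 tp0.
    have [Y _ _] := behind _ tp0.
    rewrite mulfK ?gt_eqF // cospi sinpi => YE; clear -Y YE q20; lra.
  have alE : rho * (tau / rho + pi) = tau + rho * pi.
    by rewrite mulrDr [rho * (_ / _)]mulrC divfK // gt_eqF.
  exists (tau / rho + pi), (- ahead_of th x y q tau); split.
  - have taurho0 : 0 < tau / rho by rewrite divr_gt0.
    by have := pi_gt0 R; clear -taurho0 taupi; lra.
  - by clear -Ytau; lra.
  - split; rewrite alE.
    + by rewrite {1}Tau; ring.
    + move=> t; rewrite add0r => /andP[t0 tt]; rewrite subr0 th0.
      have [tt1|tt1] := leP t tau; first by rewrite turn1 // (ltW t0).
      by rewrite turn2 ?tt1 // turn1 // mulrBl; ring.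
    + move=> t; rewrite add0r th0 => tt; have [-> ->] := straight2 t tt.
      by rewrite turn1 //; split; congr (_ _); ring.
- exfalso.
  have cNX : continuous_on 0 tau (fun t => - right_of th x y q t).
    by move=> t t01; apply: continuousN; apply: cX; clear -t01 tauT; lra.
  have [|| sig [sig0 sigtau Xsig _]] := first_hit (ltW tau0) cNX (c := 0).
  - by rewrite right0 oppr_lt0.
  - by rewrite E opprK mulr_ge0 // ltW.
  have {}Xsig : right_of th x y q sig = 0 by clear -Xsig; lra.
  have C3 := dubins_curveS (lexx 0) sigtau C1.
  have C4 := dubins_curve_reflect (dubins_curveS (ltW sig0) (lexx tau) C1).
  have C5 := dubins_curve_reflect C2.
  have behindR t : 0 <= t <= sig -> ahead_of th x y q t < 0 /\ 0 < power_of rho th x y q t.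
    by move=> t0s; have [] := behind t; [clear -t0s sigtau; lra|].
  have growth1 := behind_time_growth rho0 (ltW sig0) C3 behindR.
  pose q' := (- q.1, q.2).
  have rE t := relative_reflect th x y q t.
  have behindL t : sig <= t <= tau ->
      ahead_of (fun t => pi - th t) (fun t => - x t) y q' t < 0 /\
      0 < power_of rho (fun t => pi - th t) (fun t => - x t) y q' t.
    by move=> t0s; rewrite power_reflect (rE t).2; have [] := behind t; [clear -t0s sig0; lra|].
  have growth2 := behind_time_growth rho0 sigtau C4 behindL.
  move: growth2; rewrite !(rE _).1 !(rE _).2 Xsig E oppr0 opprK.
  have [dtau altau] := behind_half_turn rho Ytau.
  rewrite {2}/behind_time dtau altau => growth2.
  move: (growth1); rewrite -front0 Xsig add0r => growth1'.
  (* The mirrored half turn again forces equality throughout, hence no growth on [0, sig] and a pure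
     right turn there. *)
  have [Tau _ _] : RS_motion rho tau T (fun t => pi - th t)
      pi (- ahead_of (fun t => pi - th t) (fun t => - x t) y q' tau).
    apply: (half_turn_calibration rho0 tauT C5 (q := q')) => //.
    - by rewrite xT.
    - by rewrite (rE tau).1 E opprK.
    - by rewrite (rE tau).2.
    - by rewrite (rE tau).2; clear -growth1' growth2 Tle; lra.
  have turn1 : forall t, 0 <= t <= sig -> th t = th 0 - (t - 0) / rho.
    apply: (behind_time_rigid rho0 (ltW sig0) C3 behindR).
    by rewrite -front0 Xsig; move: Tau; rewrite (rE tau).2 => Tau; clear -Tau growth2 Tle; lra.
  have {}turn1 t : 0 <= t <= sig -> th t = pi / 2 - t / rho by move=> /turn1; rewrite subr0 th0.
  (* In a right turn X has derivative - Y / rho, which is positive while q is behind; X cannot fall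
     from q.1 > 0 to 0 at sig. *)
  pose H t := (q.1 - rho) * cos (0 + rho^-1 * (t - 0)) + (- q.2) * sin (0 + rho^-1 * (t - 0)) + rho.
  have HE t : 0 <= t <= sig -> H t = right_of th x y q t.
    move=> t0s; rewrite (right_arc_relative q rho0 C3 x0 y0 turn1 t0s).1.
    by rewrite /H add0r subr0 [_^-1 * _]mulrC; ring.
  have : H 0 <= H sig.
    apply: (derive_ge0_le (ltW sig0)
      (df := fun t => (q.1 - rho) * - (rho^-1 * sin (0 + rho^-1 * (t - 0))) + (- q.2) * (rho^-1 * cos (0 + rho^-1 * (t - 0))))).
      by move=> t _; apply: is_derive_lincomb; [exact: is_derive_cos_affine|exact: is_derive_sin_affine].
    move=> t t0s; have t0s' : 0 <= t <= sig by clear -t0s; lra.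
    have [Y _] := behindR t t0s'.
    move: Y; rewrite (right_arc_relative q rho0 C3 x0 y0 turn1 t0s').2 => Y.
    rewrite add0r subr0 [_^-1 * t]mulrC.
    rewrite (_ : _ + _ = rho^-1 * - ((q.1 - rho) * sin (t / rho) + q.2 * cos (t / rho))); last ring.
    by apply: mulr_ge0; [rewrite invr_ge0 ltW|clear -Y; lra].
  rewrite (HE 0) ?(HE sig) ?right0 ?Xsig ?lexx ?(ltW sig0) //.
  by rewrite leNgt q10.
Qed.

End Optimality.

(** * Paths of prescribed length *)

Section Construction.
Variable R : realType.
Implicit Types (rho T s t : R) (u : R -> R).
Notation clm := (@completed_lebesgue_measure R).
Notation ctype := (caratheodory_type (mu_ext (@wlength R idfun))).

Lemma trajectory_start rho T a u (z : R -> config R) : 0 <= T ->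
  dubins_trajectory rho T a u z -> z 0 = a.
Proof.
move=> T0 tr; have [|E1 E2 E3] := tr 0; first by rewrite lexx.
have clm0 : (\int[clm]_(r in `[0%R, 0%R]) (u r / rho))%R = 0.
  rewrite (@eq_Rintegral _ _ _ _ _ (fun=> u 0 / rho)); last first.
    by move=> r; rewrite inE /= in_itv /= => /andP[? ?]; rewrite (_ : r = 0) //; lra.
  rewrite Rintegral_cst; last exact: lebesgue_measurable_itv.
  have -> : fine (clm `[0, 0]%classic) = 0.
    by rewrite completed_itv // subrr.
  by rewrite mulr0.
rewrite set_itv1 !Rintegral_set1 !addr0 in E2 E3.
rewrite clm0 addr0 in E1.
rewrite [z 0]surjective_pairing [(z 0).1]surjective_pairing.
rewrite [RHS]surjective_pairing [a.1]surjective_pairing.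
by congr ((_, _), _).
Qed.

(** A switching time belongs to the phase that it ends, which matches the half-open intervals of
    [trajectory_heading_const]. *)
Definition switching (t1 t2 t3 : R) t : R :=
  if t <= t1 then 1 else if t <= t2 then 0 else if t <= t3 then -1 else 0.

Lemma switching_admissible T t1 t2 t3 : admissible_control T (switching t1 t2 t3).
Proof.
have mle (c : R) : measurable_fun setT ((fun t => t <= c) : ctype -> bool).
  apply: (measurable_fun_bool true).
  rewrite setTI (_ : _ @^-1` _ = [set` `]-oo, c]]); first exact: lebesgue_measurable_itv.
  by apply/seteqP; split => t /=; rewrite in_itv.
split; last first.
  move=> t _; rewrite /switching; case: ifP => _; first lra.
  by case: ifP => _; [lra|case: ifP => _; lra].
apply: measurable_funTS.
apply: measurable_fun_ifT; [exact: mle|exact: measurable_cst|].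
apply: measurable_fun_ifT; [exact: mle|exact: measurable_cst|].
by apply: measurable_fun_ifT; [exact: mle|exact: measurable_cst|exact: measurable_cst].
Qed.

Lemma control_trajectory rho T a u : exists z, dubins_trajectory rho T a u z.
Proof.
pose th t := heading a + (\int[clm]_(s in `[0, t]) (u s / rho))%R.
exists (fun t =>
  (((pos a).1 + (\int[@lebesgue_measure R]_(s in `[0%R, t]) cos (th s))%R,
    (pos a).2 + (\int[@lebesgue_measure R]_(s in `[0%R, t]) sin (th s))%R), th t)).
by move=> t _; split.
Qed.

Lemma LSRS_reach rho beta s alpha d : 0 < rho ->
  0 <= beta -> 0 <= s -> 0 <= alpha -> 0 <= d ->
  let T := rho * beta + s + rho * alpha + d in
  let th1 := pi / 2 + beta in
  let th2 := th1 - alpha in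
  exists u z, [/\ admissible_control T u, dubins_trajectory rho T (z0 R) u z
    & pos (z T) =
      (rho * (sin th1 - 1) + s * cos th1 + rho * (sin th1 - sin th2) + d * cos th2,
       - (rho * cos th1) + s * sin th1 + rho * (cos th2 - cos th1) + d * sin th2)].
Proof.
move=> rho0 b0 s0 al0 d0 T th1 th2.
pose t1 := rho * beta; pose t2 := t1 + s; pose t3 := t2 + rho * alpha.
have t10 : 0 <= t1 by rewrite /t1 mulr_ge0 // ltW.
have t12 : t1 <= t2 by rewrite /t2; lra.
have t23 : t2 <= t3 by rewrite /t3 lerDl mulr_ge0 // ltW.
have t3T : t3 <= T by rewrite /T /t3 /t2 /t1; lra.
have T0 : 0 <= T by lra.
have adm : admissible_control T (switching t1 t2 t3) by exact: switching_admissible.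
have [z tr] := control_trajectory rho T (z0 R) (switching t1 t2 t3).
exists (switching t1 t2 t3), z; split => //.
have [th [x [y [C zE]]]] := trajectory_curve rho0 T0 adm tr.
have hE t : 0 <= t <= T -> heading (z t) = th t by move=> /zE ->.
have z00 := trajectory_start T0 tr.
have t0T : 0 <= (0 : R) <= T by rewrite lexx.
have [x0 y0 th0] : [/\ x 0 = 0, y 0 = 0 & th 0 = pi / 2].
  by move: z00; rewrite zE // => -[-> -> ->].
have const a b k : 0 <= a -> b <= T -> (forall t, a < t <= b -> switching t1 t2 t3 t = k) ->
    forall t, a <= t <= b -> th t = th a + k / rho * (t - a).
  move=> a0 bT uk t tab.
  have H : heading (z t) = heading (z a) + k * (t - a) / rho.
    apply: (trajectory_heading_const rho0 adm tr); [lra|lra|lra|].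
    by move=> r art; apply: uk; lra.
  by rewrite mulrAC -(hE t) ?H ?hE //; lra.
have rn0 : rho != 0 by rewrite gt_eqF.
have L : forall t, 0 <= t <= t1 -> th t = th 0 + 1 / rho * (t - 0).
  by apply: const; [lra|lra|move=> t /andP[_ tt]; rewrite /switching tt].
have S1 : forall t, t1 <= t <= t2 -> th t = th t1 + 0 / rho * (t - t1).
  apply: const; [lra|lra|move=> t /andP[tt1 tt2]].
  by rewrite /switching leNgt tt1 /= tt2.
have Rt : forall t, t2 <= t <= t3 -> th t = th t2 + -1 / rho * (t - t2).
  apply: const; [lra|lra|move=> t /andP[tt1 tt2]].
  by rewrite /switching !leNgt (le_lt_trans t12 tt1) tt1 /= -leNgt tt2.
have S2 : forall t, t3 <= t <= T -> th t = th t3 + 0 / rho * (t - t3).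
  apply: const; [lra|lra|move=> t /andP[tt1 _]].
  by rewrite /switching !leNgt (le_lt_trans t12 (le_lt_trans t23 tt1)) (le_lt_trans t23 tt1) tt1.
have tht1 : th t1 = th1.
  rewrite L ?t10 ?lexx // th0 /th1 /t1 subr0 div1r mulKf //.
have tht2 : th t2 = th1 by rewrite S1 ?t12 ?lexx // tht1 mul0r mul0r addr0.
have tht3 : th t3 = th2.
  by rewrite Rt ?t23 ?lexx // tht2 /th2 /t3; field.
have ir0 : 1 / rho != 0 by rewrite div1r invr_neq0.
have nr0 : -1 / rho != 0 by rewrite mulN1r oppr_eq0 invr_neq0.
have [|X1 Y1] := arc_position (c := th 0) t10 ir0 (dubins_curveS (lexx 0) (le_trans t12 (le_trans t23 t3T)) C).
  by move=> t tt; apply: L; lra.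
have [|X2 Y2] := straight_position (c := cos th1) (s := sin th1) t12 (dubins_curveS t10 (le_trans t23 t3T) C).
  by move=> t tt; rewrite S1 ?tht1 ?mul0r ?mul0r ?addr0 //; lra.
have [|X3 Y3] := arc_position (c := th t2) t23 nr0 (dubins_curveS (le_trans t10 t12) t3T C).
  by move=> t tt; apply: Rt; lra.
have [|X4 Y4] := straight_position (c := cos th2) (s := sin th2) t3T
    (dubins_curveS (le_trans t10 (le_trans t12 t23)) (lexx T) C).
  by move=> t tt; rewrite S2 ?tht3 ?mul0r ?mul0r ?addr0 //; lra.
have A1 : th 0 + 1 / rho * (t1 - 0) = th1 by rewrite -L ?t10 ?lexx.
have A3 : th t2 + -1 / rho * (t3 - t2) = th2 by rewrite -Rt ?t23 ?lexx.
rewrite A1 th0 sin_pihalf cos_pihalf x0 y0 in X1 Y1.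
rewrite A3 tht2 in X3 Y3.
rewrite zE; last by rewrite T0 lexx.
have i1 : (1 / rho)^-1 = rho by rewrite div1r invrK.
have i2 : (-1 / rho)^-1 = - rho by rewrite mulN1r invrN invrK.
rewrite /pos /= X4 Y4 X3 Y3 X2 Y2 X1 Y1 i1 i2.
rewrite (_ : T - t3 = d); last by rewrite /T /t3 /t2 /t1; ring.
rewrite (_ : t2 - t1 = s); last by rewrite /t2; ring.
by congr (_, _); ring.
Qed.

End Construction.

(** * Attaining every length from V on *)

Section Longer.
Variable R : realType.
Implicit Types (rho T s t X Y : R) (u : R -> R) (q : R * R).

Definition reaches rho T q : Prop :=
  exists u z, [/\ admissible_control T u, dubins_trajectory rho T (z0 R) u z
    & pos (z T) = q].

Lemma front_time_ge0 rho X Y : 0 < rho -> 0 <= front_time rho X Y.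
Proof.
move=> rho0; apply: addr_ge0; last exact: sqrtr_ge0.
by apply: mulr_ge0 (ltW rho0) _; have /andP[/ltW] := arc_angle_bounds (- (tangent_length rho X Y + Y) / X).
Qed.

Lemma continuous_front_time rho (X Y : R -> R) t :
  {for t, continuous X} -> {for t, continuous Y} -> X t != 0 ->
  {for t, continuous (fun r => front_time rho (X r) (Y r))}.
Proof.
move=> cX cY Xt.
have cd : {for t, continuous (fun r => tangent_length rho (X r) (Y r))}.
  apply: (@continuous_comp _ _ _ (fun r => circle_power rho (X r) (Y r)) Num.sqrt); last exact: sqrt_continuous.
  apply: continuousB; first by apply: continuousD; exact: continuousM.
  by apply: continuousM cX; exact: cvg_cst.
apply: continuousD => //; apply: continuousM; first exact: cvg_cst.
apply: continuousD; first exact: cvg_cst.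
apply: continuousM; first exact: cvg_cst.
apply: (@continuous_comp _ _ _ (fun r => - (tangent_length rho (X r) (Y r) + Y r) / X r) atan); last exact: continuous_atan.
apply: continuousM; last exact: continuousV.
by apply: continuousN; exact: continuousD.
Qed.

Lemma continuous_on_IVT (f : R -> R) a b v : a <= b -> continuous_on a b f ->
  f a <= v -> v <= f b -> exists2 c, a <= c <= b & f c = v.
Proof.
move=> ab cf fa fb.
have [|c] := IVT ab (continuous_on_within cf) (v := v).
  by rewrite ge_min fa le_max fb orbT.
by rewrite in_itv /= => cab fc; exists c.
Qed.

(** (X, Y) is q seen after the left arc and the segment: the arc rotates q clockwise about the
    centre (- rho, 0) by beta, and the segment lowers Y by s. *)
Lemma reach_LSRS rho q beta s : 0 < rho -> 0 <= beta -> 0 <= s ->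
  let X := (q.1 + rho) * cos beta + q.2 * sin beta - rho in
  let Y := q.2 * cos beta - (q.1 + rho) * sin beta - s in
  0 < X -> 0 <= circle_power rho X Y ->
  reaches rho (rho * beta + s + front_time rho X Y) q.
Proof.
move=> rho0 b0 s0 X Y X0 pw.
have /andP[/ltW al0 _] : 0 < front_angle rho X Y < 2 * pi by exact: arc_angle_bounds.
have d0 : 0 <= tangent_length rho X Y by exact: sqrtr_ge0.
have [u [z [adm tr posz]]] := LSRS_reach rho0 b0 s0 al0 d0.
exists u, z; rewrite /front_time !addrA; split => //; rewrite posz.
have [EX EY] := front_relative X0 pw.
pose th1 := pi / 2 + beta.
have c1 : cos th1 = - sin beta by rewrite /th1 addrC cosDpihalf.
have s1 : sin th1 = cos beta by rewrite /th1 addrC sinDpihalf.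
pose xs := rho * (sin th1 - 1) + s * cos th1.
pose ys := - (rho * cos th1) + s * sin th1.
have cs := cos2Dsin2 beta.
have rX : right_of (fun=> th1) (fun=> xs) (fun=> ys) q 0 = X.
  transitivity ((q.1 + rho) * cos beta + q.2 * sin beta - rho * (cos beta ^+ 2 + sin beta ^+ 2)).
    by rewrite /right_of /xs /ys c1 s1; ring.
  by rewrite cs mulr1.
have rY : ahead_of (fun=> th1) (fun=> xs) (fun=> ys) q 0 = Y.
  transitivity (q.2 * cos beta - (q.1 + rho) * sin beta - s * (cos beta ^+ 2 + sin beta ^+ 2)).
    by rewrite /ahead_of /xs /ys c1 s1; ring.
  by rewrite cs mulr1.
have [|w1 w2] := RS_world (alpha := front_angle rho X Y) (d := tangent_length rho X Y) (rho := rho) (etrans rX EX).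
  by rewrite rY.
by rewrite [RHS]surjective_pairing w1 w2; congr (_, _); rewrite /xs /ys -/th1; ring.
Qed.

(* The right-turning circle never sweeps over q while driving straight ahead. *)
Lemma straight_detour rho X Y t : 0 < rho -> 0 < X -> 2 * rho <= X \/ Y <= 0 ->
  0 <= circle_power rho X Y -> front_time rho X Y <= t ->
  exists s, [/\ 0 <= s, 0 <= circle_power rho X (Y - s)
              & s + front_time rho X (Y - s) = t].
Proof.
move=> rho0 X0 XY pw Vt.
have t0 : 0 <= t by apply: le_trans Vt; exact: front_time_ge0.
(* At s = t the sum is at least t because [front_time] is nonnegative. Since the square root is 0 on
   negative numbers, continuity holds even where the power might be negative; its sign is checked
   afterwards. *)
have [|||s /andP[s0 st] E] := @continuous_on_IVT (fun s => s + front_time rho X (Y - s)) 0 t t t0.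
- move=> s _; apply: continuousD; first exact: cvg_id.
  apply: continuous_front_time; last by rewrite gt_eqF.
    exact: cvg_cst.
  by apply: continuousB; [exact: cvg_cst|exact: cvg_id].
- by rewrite subr0 add0r.
- by rewrite lerDl; exact: front_time_ge0.
exists s; split => //.
case: XY => [X2|Y0].
  have : 0 <= X * (X - 2 * rho) by apply: mulr_ge0; lra.
  by have := sqr_ge0 (Y - s); rewrite /circle_power; lra.
have : 0 <= - Y * s by apply: mulr_ge0; lra.
by have := sqr_ge0 s; move: pw; rewrite /circle_power; lra.
Qed.

(* Far from the left circle, turn left until q is exactly to the right, which
   reduces to straight_detour. *)
Lemma reach_longer rho q t : 0 < rho -> 0 < q.1 -> 0 <= circle_power rho q.1 q.2 ->
  (q.2 <= 0 \/ 9 * rho ^+ 2 <= (q.1 + rho) ^+ 2 + q.2 ^+ 2) ->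
  front_time rho q.1 q.2 <= t -> reaches rho t q.
Proof.
move=> rho0 q10 pw far Vt.
have [near_|/not_orP[q12 q20]] := pselect (2 * rho <= q.1 \/ q.2 <= 0).
  have [s [s0 pws <-]] := straight_detour rho0 q10 near_ pw Vt.
  have := @reach_LSRS rho q 0 s rho0 (lexx 0) s0.
  rewrite cos0 sin0 !mulr0 !mulr1 addr0 subr0 addrK add0r; exact.
case: far => // far.
have {}q12 : q.1 < 2 * rho by rewrite ltNge; exact/negP.
have {}q20 : 0 < q.2 by rewrite ltNge; exact/negP.
(* (m, psi) are the polar coordinates of q about the centre (- rho, 0) of the left-turning circle,
   so that psi is the left turn after which q is exactly abeam, at X = m - rho. *)
pose m := Num.sqrt ((q.1 + rho) ^+ 2 + q.2 ^+ 2).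
have m2 : m ^+ 2 = (q.1 + rho) ^+ 2 + q.2 ^+ 2 by rewrite sqr_sqrtr // addr_ge0 ?sqr_ge0.
have m0 : 0 <= m by exact: sqrtr_ge0.
have m3 : 3 * rho <= m.
  by rewrite -(ler_pXn2r (n := 2)) ?nnegrE //; [rewrite m2; lra|lra].
have mpos : 0 < m by lra.
pose psi := acos ((q.1 + rho) / m).
have cm : 0 < (q.1 + rho) / m by rewrite divr_gt0 //; lra.
have cm1 : (q.1 + rho) / m <= 1.
  rewrite ler_pdivrMr // mul1r -(ler_pXn2r (n := 2)) ?nnegrE //; last lra.
  by rewrite m2; have := sqr_ge0 q.2; lra.
have cm2 : -1 <= (q.1 + rho) / m <= 1 by lra.
have psi0 : 0 <= psi by exact: acos_ge0.
have psipi : psi <= pi by exact: acos_lepi.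
have cpsi : q.1 + rho = m * cos psi.
  by rewrite acosK ?in_itv //= mulrC divfK // gt_eqF.
have spsi : q.2 = m * sin psi.
  rewrite sin_acos // -{1}(ger0_norm m0) -sqrtr_sqr -sqrtrM ?sqr_ge0 //.
  rewrite mulrBr mulr1 -exprMn mulrCA mulfV ?gt_eqF // mulr1 m2 addrAC subrr add0r.
  by rewrite sqrtr_sqr gtr0_norm.
pose X b := (q.1 + rho) * cos b + q.2 * sin b - rho.
pose Y b := q.2 * cos b - (q.1 + rho) * sin b - 0.
have XE b : X b = m * cos (psi - b) - rho by rewrite /X {1}cpsi {1}spsi cosB; ring.
have YE b : Y b = m * sin (psi - b) by rewrite /Y {1}cpsi {1}spsi sinB; ring.
have Xpos b : 0 <= b <= psi -> 0 < X b.
  move=> /andP[b0 bpsi]; rewrite XE; have : cos psi <= cos (psi - b).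
    by apply: cos_le_sym; lra.
  by rewrite -(ler_pM2l mpos); lra.
(* During the left turn the centre of the right-turning circle keeps the distance 2 rho from (- rho,
   0), so that circle stays within distance 3 rho of it; this is where the bound 9 * rho ^+ 2
   enters. Algebraically, the power is at least (m - rho) * (m - 3 * rho). *)
have Xpw b : 0 <= circle_power rho (X b) (Y b).
  have -> : circle_power rho (X b) (Y b) = m ^+ 2 - 4 * rho * m * cos (psi - b) + 3 * rho ^+ 2.
    transitivity (m ^+ 2 * (cos (psi - b) ^+ 2 + sin (psi - b) ^+ 2) - 4 * rho * m * cos (psi - b) + 3 * rho ^+ 2).
      by rewrite XE YE /circle_power; ring.
    by rewrite cos2Dsin2 mulr1.
  have : rho * m * cos (psi - b) <= rho * m by rewrite ler_piMr ?mulr_ge0 ?cos_le1 // ltW.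
  have : 0 <= (m - rho) * (m - 3 * rho) by apply: mulr_ge0; lra.
  lra.
pose G b := rho * b + 0 + front_time rho (X b) (Y b).
have cG : continuous_on 0 psi G.
  have cc : continuous (@cos R) by exact: continuous_cos.
  have cs : continuous (@sin R) by exact: continuous_sin.
  move=> b bpsi; apply: continuousD.
    by apply: continuousD; [apply: continuousM; [exact: cvg_cst|exact: cvg_id]|exact: cvg_cst].
  apply: continuous_front_time; last by rewrite gt_eqF // Xpos.
    apply: continuousB; last exact: cvg_cst.
    by apply: continuousD; apply: continuousM; (exact: cvg_cst || exact: cc || exact: cs).
  apply: continuousB; last exact: cvg_cst.
  by apply: continuousB; apply: continuousM; (exact: cvg_cst || exact: cc || exact: cs).
have G0 : G 0 <= t.
  by rewrite /G /X /Y cos0 sin0 !mulr0 !mulr1 !addr0 !subr0 addrK add0r.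
have [Gt|Gt] := leP t (G psi).
  have [b bpsi <-] := continuous_on_IVT psi0 cG G0 Gt.
  have /andP[b0 _] := bpsi.
  exact: (reach_LSRS rho0 b0 (lexx 0) (Xpos b bpsi) (Xpw b)).
have Xpsi : 2 * rho <= X psi by rewrite XE subrr cos0; lra.
have Vt2 : front_time rho (X psi) (Y psi) <= t - rho * psi by move: Gt; rewrite /G; lra.
have Xp : 0 < X psi by lra.
have [s [s0 pws sE]] := straight_detour rho0 Xp (or_introl Xpsi) (Xpw psi) Vt2.
have /= := @reach_LSRS rho q psi s rho0 psi0 s0.
have -> : q.2 * cos psi - (q.1 + rho) * sin psi - s = Y psi - s by rewrite /Y; ring.
rewrite -/(X psi).
have -> : rho * psi + s + front_time rho (X psi) (Y psi - s) = t by rewrite -addrA sE; ring.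
exact.
Qed.

End Longer.

(** * Interception *)

Section Interception.
Variable R : realType.
Implicit Types (rho T s t : R) (q : R * R).

(** For x > 0 the centre (- rho, 0) is the farther one, so being within 3 rho of it implies the same
    for (rho, 0). Outside [R3], a point with y > 0 must therefore be at least 3 rho from (- rho,
    0). *)
Lemma R1_right_half_plane rho q : 0 < rho -> (R1 rho `&` [set q : R * R | 0 < q.1]) q ->
  [/\ 0 < q.1, 0 < circle_power rho q.1 q.2, 0 < circle_power rho (- q.1) q.2
    & q.2 <= 0 \/ 9 * rho ^+ 2 <= (q.1 + rho) ^+ 2 + q.2 ^+ 2].
Proof.
move=> rho0 [/not_orP[/not_orP[nDr nDl] nR3]] /= q1.
have {}nDr : 0 < circle_power rho q.1 q.2.
  by rewrite ltNge; apply/negP => H; apply: nDr; move: H; rewrite /Dr /circle_power /=; lra.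
have {}nDl : 0 < circle_power rho (- q.1) q.2.
  by rewrite ltNge; apply/negP => H; apply: nDl; move: H; rewrite /Dl /circle_power /=; lra.
split => //; have [?|q2] := leP q.2 0; [by left|right].
rewrite leNgt; apply/negP => far; apply: nR3; split.
  split => //; last exact: ltW.
  by have : 0 < rho * q.1 by [exact: mulr_gt0]; lra.
move=> [[H|H] _]; [move: nDr|move: nDl]; move: H; rewrite /Dr /Dl /circle_power /=; lra.
Qed.

Lemma intercept_by_front_time rho (p v : R * R) tm u z :
  0 < rho -> mtip_solution rho p v tm u z ->
  interior (R1 rho `&` [set q : R * R | 0 < q.1]) (target p v tm) ->
  tm <= front_time rho (target p v tm).1 (target p v tm).2.
Proof.
move=> rho0 [tm0 _ opt] int; rewrite leNgt; apply/negP => Vtm.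
have c1 : {for tm, continuous (fun t => (target p v t).1)}.
  apply: continuousD; first exact: cvg_cst.
  by apply: continuousM; [exact: cvg_id|exact: cvg_cst].
have c2 : {for tm, continuous (fun t => (target p v t).2)}.
  apply: continuousD; first exact: cvg_cst.
  by apply: continuousM; [exact: cvg_id|exact: cvg_cst].
have cE : {for tm, continuous (target p v)} by exact: cvg_pair c1 c2.
have near1 : \forall t \near tm, (R1 rho `&` [set q : R * R | 0 < q.1]) (target p v t).
  exact: (cE _ int).
have [q1 _ _ _] := R1_right_half_plane rho0 (nbhs_singleton near1).
have cV : {for tm, continuous (fun t => t - front_time rho (target p v t).1 (target p v t).2)}.
  apply: continuousB; first exact: cvg_id.
  by apply: continuous_front_time => //; rewrite gt_eqF.
have near2 : \forall t \near tm, 0 < t - front_time rho (target p v t).1 (target p v t).2.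
  by apply: (cvgr_gt _ cV); rewrite subr_gt0.
have : \forall t \near tm^'-, False; last by move=> /filter_ex[].
near=> t.
have ttm : t < tm by near: t; exact: nbhs_left_lt.
have t0 : 0 < t by near: t; exact: nbhs_left_gt.
have reg : (R1 rho `&` [set q : R * R | 0 < q.1]) (target p v t).
  by near: t; rewrite near_withinE; apply: filterS near1.
have Vt : 0 < t - front_time rho (target p v t).1 (target p v t).2.
  by near: t; rewrite near_withinE; apply: filterS near2.
have [E1 Npos _ far] := R1_right_half_plane rho0 reg.
have [|u' [z' [adm tr posz]]] := reach_longer rho0 E1 (ltW Npos) far (t := t).
  by rewrite -subr_ge0 ltW.
have : tm <= t by apply: opt => //; exists u', z'; split.
by rewrite leNgt ttm.
Unshelve. all: by end_near. Qed.

Lemma RS_motion_path rho T th x y alpha d : 0 < rho ->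
  dubins_curve rho 0 T th x y -> th 0 = pi / 2 -> x 0 = 0 -> y 0 = 0 ->
  0 <= alpha -> 0 <= d -> RS_motion rho 0 T th alpha d ->
  path_RS rho (z0 R) alpha d T (fun t => (x t, y t)).
Proof.
move=> rho0 C th0 x0 y0 al0 d0; rewrite /RS_motion add0r th0 => -[TE turn straight].
have rn0 : - rho^-1 != 0 by rewrite oppr_eq0 invr_neq0 // gt_eqF.
have m0 : 0 <= rho * alpha by rewrite mulr_ge0 // ltW.
have mT : rho * alpha <= T by lra.
have arc t : 0 <= t <= rho * alpha -> (x t, y t) = pos (Defs.right_arc rho (z0 R) t).
  move=> /andP[t0 tm].
  have [|] := arc_position (c := pi / 2) t0 rn0 (dubins_curveS (lexx 0) (le_trans tm mT) C).
    by move=> s s0t; rewrite turn ?subr0 ?mulNr 1?[_^-1 * _]mulrC //; lra.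
  rewrite subr0 mulNr [_^-1 * t]mulrC invrN invrK x0 y0 => -> ->.
  by rewrite /Defs.right_arc /pos /z0 /=; congr (_, _); ring.
split => // t /andP[mt tT].
have rho_al : rho * alpha / rho = alpha by rewrite mulrC mulKf // gt_eqF.
have [|] := straight_position mt (dubins_curveS m0 tT C) (c := cos (pi / 2 - alpha)) (s := sin (pi / 2 - alpha)).
  by move=> s s0t; apply: straight; lra.
have := arc (rho * alpha); rewrite m0 lexx => /(_ isT) -[E1 E2].
rewrite E1 E2 => -> ->.
by rewrite /straight /pos /Defs.right_arc /z0 /= rho_al.
Qed.

Lemma RS_intercept_Gcs rho (p v : R * R) alpha d (gamma : R -> R * R) T :
  0 < rho -> path_RS rho (z0 R) alpha d T gamma -> gamma T = target p v T ->
  Gcs rho p v alpha = 0.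
Proof.
move=> rho0 [al0 d0 TE _ straight].
have rho_al : rho * alpha / rho = alpha by rewrite mulrC mulKf // gt_eqF.
have -> := straight T; last by rewrite lexx TE lerDl d0.
rewrite (_ : T - rho * alpha = d); last by rewrite TE; ring.
rewrite /straight /pos /Defs.right_arc /z0 /target /= rho_al TE !sinB !cosB sin_pihalf cos_pihalf.
rewrite !mul0r !mul1r add0r subr0 => -[E1 E2].
have cs := cos2Dsin2 alpha.
rewrite /Gcs; set c := cos alpha in E1 E2 cs *; set s := sin alpha in E1 E2 cs *.
have F1 : d * (s - v.1) = p.1 + rho * alpha * v.1 - rho * (1 - c) by lra.
have F2 : d * (c - v.2) = p.2 + rho * alpha * v.2 - rho * s by lra.
(* Cross-multiplying eliminates d without dividing, so no case distinction on vanishing factors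
   arises; the result is [Gcs] up to a multiple of 1 - (c ^+ 2 + s ^+ 2). *)
have E0 : (c - v.2) * (d * (s - v.1)) - (s - v.1) * (d * (c - v.2)) = 0 by ring.
rewrite F1 F2 in E0.
transitivity ((c - v.2) * (p.1 + rho * alpha * v.1 - rho * (1 - c)) -
    (s - v.1) * (p.2 + rho * alpha * v.2 - rho * s) + rho * (1 - (c ^+ 2 + s ^+ 2))).
  by ring.
by rewrite E0 cs subrr mulr0 addr0.
Qed.

End Interception.

Unset Implicit Arguments.

Theorem lemma7 (R : realType) (rho : R) (p v : R * R)
    (tm : R) (u : R -> R) (z : R -> config R) :
  0 < rho ->
  euclidean_norm v < 1 ->
  mtip_solution rho p v tm u z ->
  interior (R1 rho `&` [set q : R * R | 0 < q.1]) (target p v tm) ->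
  exists alpha d : R,
    [/\ 0 <= alpha <= 2 * pi,
        path_RS rho (z0 R) alpha d tm (fun t => pos (z t))
      & Gcs rho p v alpha = 0].
Proof.
move=> rho0 _ sol int; have [tm0 [adm tr posz] _] := sol.
have tm_le := intercept_by_front_time rho0 sol int.
have [q1 Npos Lpos _] := R1_right_half_plane rho0 (interior_subset int).
have [th [x [y [C zE]]]] := trajectory_curve rho0 (ltW tm0) adm tr.
have t0T : 0 <= (0 : R) <= tm by rewrite lexx ltW.
have tmT : 0 <= tm <= tm by rewrite lexx ltW.
have [x0 y0 th0] : [/\ x 0 = 0, y 0 = 0 & th 0 = pi / 2].
  by move: (trajectory_start (ltW tm0) tr); rewrite zE // => -[-> -> ->].
have [xT yT] : x tm = (target p v tm).1 /\ y tm = (target p v tm).2.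
  by rewrite -posz zE.
have [alpha [d [al02 d0 motion]]] :=
  RS_optimal rho0 tm0 C th0 x0 y0 xT yT q1 Npos Lpos tm_le.
have /andP[al0 _] := al02.
have [a1 a2 a3 a4 a5] := RS_motion_path rho0 C th0 x0 y0 al0 d0 motion.
have path : path_RS rho (z0 R) alpha d tm (fun t => pos (z t)).
  split=> // t tt.
    by rewrite -a4 // zE //; have : 0 <= d by []; lra.
  by rewrite -a5 // zE //; have : 0 <= rho * alpha by [rewrite mulr_ge0 // ltW]; lra.
by exists alpha, d; split=> //; exact: RS_intercept_Gcs path posz.
Qed.
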